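(* Let $0<r\le1$ and $i\ge0$, and let $X_n\subseteq S^1$ be a set of $n$ points chosen independently and uniformly at random from $S^1$. Then the expected fraction of points at level $i$ satisfies \[ \ell_i(r):=\lim_{n\to\infty}\frac{\mathbf{E}[\mathrm{lev}_i(X_n,r)]}{n}=\begin{cases}\frac{1}{2^{2i+1}}C_i & \text{if } r\notin\mathbb{Q},\\ \frac{1}{2^{2i+1}}C_{i,q-2} & \text{if } r=\frac{p}{q} \text{ with } p,q \text{ coprime positive integers}.\end{cases}\]
   Context: $S^1=\mathbb{R}/\mathbb{Z}$ with arc-length metric; $[x,y)_{S^1}$ denotes the clockwise half-open arc from $x$ to $y$. For finite $X\subseteq S^1$ and $0<r\le1$, $f_r\colon X\to X$ sends $x$ to the element of $X\cap[x,x+r)_{S^1}$ clockwise furthest from $x$; $f_r^0=\mathrm{id}_X$. A point $x$ is periodic if $f_r^j(x)=x$ for some $j\ge1$. A non-periodic point $x$ is at level $i$ if $x\in f_r^i(X)\setminus f_r^{i+1}(X)$; $\mathrm{lev}_i(X,r)$ is the number of non-periodic points at level $i$. $C_i=\frac{1}{i+1}\binom{2i}{i}$ is the $i$-th Catalan number. For integers $i\ge0$ and $h$, $C_{i,h}$ is the number of lattice paths starting at $(0,0)$ with $i$ up-steps $(1,1)$ and $i$ down-steps $(1,-1)$ such that $0\le y\le h$ for every point $(x,y)$ of the path (Dyck paths of height at most $h$). *)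

(* Defs.v *)
From HB Require Import structures.
From mathcomp Require Import all_boot all_order all_algebra.
From mathcomp Require Import generic_quotient ring_quotient finmap.
From mathcomp Require Import all_classical all_reals all_analysis.

Set Implicit Arguments.
Unset Strict Implicit.
Unset Printing Implicit Defensive.

Import Order.TTheory GRing.Theory Num.Theory.
Import numFieldNormedType.Exports.

Local Open Scope classical_set_scope.
Local Open Scope ring_scope.

(* The additive subgroup Z of R. *)
Definition integers (R : realType) : zmodClosed R :=
  GRing.ZmodClosed.clone R (@Num.int_num_subdef R) _.

Lemma integersE (R : realType) (x : R) : (x \in integers R) = (x \is a Num.int).
Proof. by []. Qed.

(* S^1 = R/Z *)
Definition circle (R : realType) : Type := Quotient.quot (integers R).

HB.instance Definition _ (R : realType) := Choice.on (circle R).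
HB.instance Definition _ (R : realType) := GRing.Zmodule.on (circle R).
HB.instance Definition _ (R : realType) := isPointed.Build (circle R) 0.

Definition to_circle (R : realType) (t : R) : circle R :=
  (\pi_(Quotient.quot (integers R)) t)%qT.

Section circle_measurable.
Variable R : realType.

(* The quotient sigma-algebra; as [to_circle] is continuous and open, it is the
   Borel sigma-algebra of the circle. *)
Definition circle_measurable : set (set (circle R)) :=
  [set A | measurable (@to_circle R @^-1` A)].

Lemma circle_measurable0 : circle_measurable set0.
Proof. by rewrite /circle_measurable /= preimage_set0. Qed.

Lemma circle_measurableC (A : set (circle R)) :
  circle_measurable A -> circle_measurable (~` A).
Proof. by rewrite /circle_measurable /= preimage_setC; exact: measurableC. Qed.

Lemma circle_measurable_bigcup (F : (set (circle R))^nat) :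
  (forall i, circle_measurable (F i)) -> circle_measurable (\bigcup_i F i).
Proof.
rewrite /circle_measurable /= => mF.
by rewrite preimage_bigcup; exact: bigcupT_measurable.
Qed.

Fact circle_display : measure_display. Proof. exact: default_measure_display. Qed.

HB.instance Definition _ := @isMeasurable.Build circle_display (circle R)
  circle_measurable circle_measurable0 circle_measurableC
  circle_measurable_bigcup.

End circle_measurable.

Definition circle_uniform (R : realType) : set (circle R) -> \bar R :=
  pushforward (uniform_prob (@ltr01 R)) (@to_circle R).

(* Increasing representatives in R correspond to moving clockwise.
   [clockwise_arc x r] is [x, x + r)_{S^1}, the half-open arc of length r starting at x;
   in particular [clockwise_arc x 1] is the whole circle. *)
Definition clockwise_arc (R : realType) (x : circle R) (r : R) : set (circle R) :=
  [set x + to_circle t | t in `[0, r[].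

(* The clockwise distance from x to y, i.e. the unique t in [0, 1) such that
   y = x + t; the value does not depend on the representative of y - x. *)
Definition clockwise_dist (R : realType) (x y : circle R) : R :=
  let t : R := repr (y - x : Quotient.quot (integers R)) in
  t - (Num.floor t)%:~R.

(* When x \in X and 0 < r such a y exists and is unique, so the default value of
   [xget] plays no role. *)
Definition furthest_map (R : realType) (X : {fset circle R}) (r : R)
    (x : circle R) : circle R :=
  xget x [set y | [/\ y \in X, clockwise_arc x r y &
    forall z, z \in X -> clockwise_arc x r z ->
      clockwise_dist x z <= clockwise_dist x y]].

Definition periodic_point (T : Type) (f : T -> T) (x : T) : Prop :=
  exists2 j : nat, (1 <= j)%N & iter j f x = x.

Definition fiter_image (R : realType) (X : {fset circle R}) (r : R) (i : nat) :
    {fset circle R} :=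
  [fset iter i (furthest_map X r) x | x in X]%fset.

Definition lev (R : realType) (i : nat) (X : {fset circle R}) (r : R) : nat :=
  #|` [fset x in X | ~~ `[< periodic_point (furthest_map X r) x >] &
        (x \in fiter_image X r i) && (x \notin fiter_image X r i.+1)]%fset|.

Definition mutually_independent d d' (T : measurableType d)
    (S : measurableType d') (R : realType) (P : probability T R) (n : nat)
    (X : 'I_n -> {RV P >-> S}) : Prop :=
  forall A : 'I_n -> set S, (forall j, measurable (A j)) ->
    P (\bigcap_j (X j @^-1` A j)) = (\prod_(j < n) P (X j @^-1` A j))%E.

Definition iid_uniform d (T : measurableType d) (R : realType)
    (P : probability T R) (n : nat) (X : 'I_n -> {RV P >-> circle R}) : Prop :=
  mutually_independent X /\
  forall (j : 'I_n) (A : set (circle R)), measurable A ->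
    distribution P (X j) A = circle_uniform A.

Definition random_set d (T : measurableType d) (R : realType)
    (P : probability T R) (n : nat) (X : 'I_n -> {RV P >-> circle R}) (w : T) :
    {fset circle R} :=
  [fset X j w | j in 'I_n]%fset.

Definition catalan (R : realType) (i : nat) : R := 'C(2 * i, i)%:R / i.+1%:R.

(* A path is its list of steps, [true] standing for (1,1) and [false] for
   (1,-1). *)
Definition path_height (s : seq bool) : int :=
  (count_mem true s)%:Z - (count_mem false s)%:Z.

(* The bound h is an integer: there is no such path when h < 0, even for
   i = 0. *)
Definition bounded_catalan (i : nat) (h : int) : nat :=
  #|[pred s : (2 * i).-tuple bool |
      [&& count_mem true s == i, count_mem false s == i &
        [forall k : 'I_(2 * i).+1, 0 <= path_height (take k s) <= h]]]|.

(* Main.v *)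
(* Let x be a point of X and x' its successor. The preimage of x under the j-th iterate of
   f_r is X /\ [a_j, b_j), where a_0 = x, b_0 = x' and a_(j+1), b_(j+1) are the first points
   of X strictly after a_j - r and b_j - r; hence x is at level i iff the two backward orbits
   coalesce exactly at step i+1. Translate the arcs just after x, x - r, x - 2r, ... onto each
   other, remembering the arc of a point as its letter. Then a and b become two greedy readers
   of one and the same word: the first waits for the letters 1, 2, ..., the second for
   0, 1, 2, ... Letters are uniform and independent, so among the steps at which a reader moves
   the difference of the two awaited letters is a simple random walk from 1, and level i means
   that it first reaches 0 at time 2i+1. If r = p/q, letters are taken mod q, and at
   difference q both readers wait for the same letter forever: this is the height bound q-2.

   To avoid a Poisson limit, the circle is cut into L arcs (L fixed) and each arc and its
   translates into M = n^3 cells. Permuting the letters of the points independently preserves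
   the law of the vector of cells, so one can average over letters first. Reading words up to
   the end of an arc leaves a bounded expected number of undecided points per arc, so that the
   expected number of points at level i is n times the walk probability up to O(1). *)

Require Import Defs.
From HB Require Import structures.
From mathcomp Require Import all_boot all_order all_algebra.
From mathcomp Require Import generic_quotient ring_quotient finmap zify ring lra.
From mathcomp Require Import all_classical all_reals all_analysis.
From mathcomp Require Import measurable_realfun.

Set Implicit Arguments.
Unset Strict Implicit.
Unset Printing Implicit Defensive.

Import Order.TTheory GRing.Theory Num.Theory.
Import numFieldNormedType.Exports.

Local Open Scope classical_set_scope.
Local Open Scope ring_scope.

(** * The circle *)

Section circle_theory.
Variable R : realType.
Implicit Types (x y z : circle R) (s t u r : R).

Lemma to_circleD s t : to_circle (s + t) = to_circle s + to_circle t.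
Proof. exact: raddfD. Qed.

Lemma to_circleN s : to_circle (- s) = - to_circle s.
Proof. exact: raddfN. Qed.

Lemma to_circleB s t : to_circle (s - t) = to_circle s - to_circle t.
Proof. exact: raddfB. Qed.

Lemma to_circle0 : to_circle 0 = 0 :> circle R.
Proof. exact: raddf0. Qed.

Lemma to_circle_eq0 t : (to_circle t = 0) <-> (t \is a Num.int).
Proof.
rewrite -to_circle0 -integersE -[t in t \in _]subr0.
have -> : (t - 0 \in integers R) = (to_circle t == to_circle 0).
  exact: Quotient.idealrBE.
by split=> [->|/eqP].
Qed.

Lemma to_circle_repr x : to_circle (repr x) = x.
Proof. exact: reprK. Qed.

Lemma to_circle_floor t : to_circle (t - (Num.floor t)%:~R) = to_circle t.
Proof.
rewrite to_circleB (_ : to_circle (_%:~R) = 0) ?subr0//.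
by apply/to_circle_eq0; rewrite intr_int.
Qed.

Lemma clockwise_dist_ge0 x y : 0 <= clockwise_dist x y.
Proof. by rewrite /clockwise_dist subr_ge0 floor_le. Qed.

Lemma clockwise_dist_lt1 x y : clockwise_dist x y < 1.
Proof.
rewrite /clockwise_dist; set t := repr _.
by have := floorD1_gt (t : R); rewrite intrD; lra.
Qed.

Lemma clockwise_distK x y : x + to_circle (clockwise_dist x y) = y.
Proof. by rewrite /clockwise_dist to_circle_floor to_circle_repr addrC subrK. Qed.

Lemma to_circle_inj s t : 0 <= s < 1 -> 0 <= t < 1 ->
  to_circle s = to_circle t -> s = t.
Proof.
move=> s01 t01 /eqP; rewrite -subr_eq0 -to_circleB => /eqP /to_circle_eq0.
move=> /intrP[k /eqP]; rewrite subr_eq => /eqP stk.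
have : -1 < (k%:~R : R) < 1 by lra.
have -> : s = t + k%:~R by lra.
rewrite -[1]/(1%:~R) -intrN !ltr_int => k0.
have -> : k = 0 by lia.
by rewrite addr0.
Qed.

Lemma clockwise_dist_unique x y t : 0 <= t < 1 -> x + to_circle t = y ->
  clockwise_dist x y = t.
Proof.
move=> t01 xty; apply: to_circle_inj => //.
  by rewrite clockwise_dist_ge0 clockwise_dist_lt1.
by apply: (addrI x); rewrite clockwise_distK.
Qed.

Lemma clockwise_arcE x y r : r <= 1 ->
  clockwise_arc x r y <-> clockwise_dist x y < r.
Proof.
move=> r1; split=> [[t /=]|xyr].
  rewrite in_itv/= => tr xty.
  by rewrite (@clockwise_dist_unique _ _ t) //; lra.
exists (clockwise_dist x y); last exact: clockwise_distK.
by rewrite /= in_itv/= clockwise_dist_ge0.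
Qed.

(** The point [x] is itself a candidate, at distance 0, so the maximum over the finite set exists
    and [xget] never returns its default. *)
Lemma furthest_mapP (X : {fset circle R}) r x : 0 < r <= 1 -> x \in X ->
  [/\ furthest_map X r x \in X, clockwise_dist x (furthest_map X r x) < r &
   forall z, z \in X -> clockwise_dist x z < r ->
     clockwise_dist x z <= clockwise_dist x (furthest_map X r x)].
Proof.
move=> r01 xX; have r1 : r <= 1 by lra.
have xx : clockwise_dist x x = 0.
  by apply: clockwise_dist_unique; rewrite ?lexx ?ltr01 ?to_circle0 ?addr0.
rewrite /furthest_map; case: xgetP => [y _ [yX xy ymax]|nomax].
  split=> //; first exact/clockwise_arcE.
  by move=> z zX xz; apply: ymax => //; apply/clockwise_arcE.
pose P := [pred y : X | clockwise_dist x (val y) < r].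
have P0 : P [` xX]%fset by rewrite /P/= xx; lra.
have [y Py ymax] := arg_maxP (fun y : X => clockwise_dist x (val y)) P0.
exfalso; apply: (nomax (val y)); split.
- exact: valP.
- exact/clockwise_arcE.
- move=> z zX /(clockwise_arcE _ _ r1) xz.
  exact: (ymax [` zX]%fset).
Qed.

End circle_theory.

(** * Iterates of the furthest-point map *)

Section dynamics.
Variables (R : realType) (r : R) (X : {fset circle R}).
Hypotheses (r_gt0 : 0 < r) (r_le1 : r <= 1).
Local Notation f := (furthest_map X r).

Let r01 : 0 < r <= 1. Proof. by rewrite r_gt0. Qed.

Lemma furthest_map_in x : x \in X -> f x \in X.
Proof. by move=> xX; have [] := furthest_mapP r01 xX. Qed.

Lemma iter_furthest_map_in k x : x \in X -> iter k f x \in X.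
Proof. by move=> xX; elim: k => //= k; apply: furthest_map_in. Qed.

Lemma mem_fiter_image k x :
  x \in fiter_image X r k <-> exists2 y, y \in X & iter k f y = x.
Proof.
split=> [/imfsetP[y /= yX ->]|[y yX <-]]; first by exists y.
by apply/imfsetP; exists y.
Qed.

Lemma fiter_image_le k l x : (k <= l)%N ->
  x \in fiter_image X r l -> x \in fiter_image X r k.
Proof.
move=> kl /mem_fiter_image[y yX <-]; apply/mem_fiter_image.
exists (iter (l - k) f y); first exact: iter_furthest_map_in.
by rewrite -iterD subnKC.
Qed.

Lemma periodic_fiter_image k x : x \in X -> periodic_point f x ->
  x \in fiter_image X r k.
Proof.
move=> xX [j j1 jx]; apply/(@fiter_image_le k (k * j)%N).
  by rewrite leq_pmulr.
apply/mem_fiter_image; exists x => //.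
by elim: k => // k IHk; rewrite mulSn iterD IHk.
Qed.

Definition level_points i : {fset circle R} :=
  [fset x in X | (x \in fiter_image X r i) &&
                 (x \notin fiter_image X r i.+1)]%fset.

(** A periodic point lies in every [fiter_image], so a point outside the image of the iterate [i.+1]
    is automatically non-periodic. *)
Lemma lev_level_points i : lev i X r = #|` level_points i|.
Proof.
rewrite /lev; congr (#|` _|); apply/fsetP => x; rewrite !inE /=.
apply: andb_id2l => xX; apply: andb_idl => /andP[_ xNi].
by apply/asboolPn => /(periodic_fiter_image i.+1 xX); apply/negP.
Qed.

Variable o : circle R.

(* The window with index [j] is the arc at [o] rotated by [- j * r]; [window_point j u]
   is its point at offset [u]. *)
Definition window_point (j : nat) (u : R) : circle R :=
  o + to_circle (u - j%:R * r).
Local Notation p := window_point.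

Lemma window_point_shift j u v : p j u + to_circle v = p j (u + v).
Proof. by rewrite /p -addrA -to_circleD addrAC. Qed.

Lemma window_pointS j u : p j.+1 u = p j (u - r).
Proof. by rewrite /p -natr1 mulrDl mul1r opprD addrA addrAC. Qed.

(** Seen from window [j], the point [p j.+1 u] has offset [u - r]. Hence [p j a] is a candidate for
    its image, which lies at or past [a], and before [u] because its distance is less than [r]. *)
Lemma furthest_map_forward j (a u : R) : a < u -> u - a <= r -> p j a \in X ->
  p j.+1 u \in X ->
  exists2 v, a <= v < u & f (p j.+1 u) = p j v.
Proof.
move: r_gt0 r_le1 => r0 r1 au uar paX puX.
have [fX fr fmax] := furthest_mapP r01 puX.
set y := p j.+1 u in fX fr fmax puX *.
have ya : clockwise_dist y (p j a) = r - (u - a).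
  apply: clockwise_dist_unique; first lra.
  by rewrite /y window_pointS window_point_shift; congr p; lra.
exists (u - r + clockwise_dist y (f y)).
  have := fmax _ paX; rewrite ya => /(_ ltac:(lra)); lra.
by rewrite -window_point_shift -window_pointS clockwise_distK.
Qed.

(** Here [u = v + r - t], where [t < r] is the distance from [y] to its image, so [v < u]. If [u]
    exceeded [b], then [p j b] would be a candidate beyond [f y]. *)
Lemma furthest_map_backward j (v b : R) y : v < b -> b - v <= r ->
  p j b \in X -> y \in X -> f y = p j v ->
  exists2 u, v < u <= b & y = p j.+1 u.
Proof.
move: r_gt0 r_le1 => r0 r1 vb bvr pbX yX fy.
have [fX fr fmax] := furthest_mapP r01 yX.
set t := clockwise_dist y (f y) in fr fmax.
have yt : y = p j.+1 (v + r - t).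
  rewrite window_pointS -[LHS](addrK (to_circle t)) clockwise_distK fy.
  by rewrite -to_circleN window_point_shift; congr p; lra.
exists (v + r - t) => //.
have t_ge0 : 0 <= t by exact: clockwise_dist_ge0.
have [tb|] := ltP (t + (b - v)) r; last by lra.
have yb : clockwise_dist y (p j b) = t + (b - v).
  apply: clockwise_dist_unique; first lra.
  by rewrite yt window_pointS window_point_shift; congr p; lra.
by have := fmax _ pbX; rewrite yb => /(_ tb); lra.
Qed.

End dynamics.

(* In a state [(A, B)] the two greedy readers wait for a point of window [A], respectively
   [B]; the letters are the numbers of the windows mod [m]. *)
Definition decided (i : nat) (st : nat * nat) : bool :=
  (st.1 == st.2) || (i.+1 < st.1)%N.

Definition success (i : nat) (st : nat * nat) : bool :=
  (st.1 == i.+1) && (st.2 == i.+1).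

Definition read_step (m i : nat) (st : nat * nat) (c : nat) : nat * nat :=
  if decided i st then st
  else (st.1 + (st.1 %% m == c), st.2 + (st.2 %% m == c))%N.

Definition read (m i : nat) : nat * nat -> seq nat -> nat * nat :=
  foldl (read_step m i).

Lemma read_decided m i st w : decided i st -> read m i st w = st.
Proof.
by move=> dst; elim: w => //= c w IHw; rewrite /read_step dst.
Qed.

(** * Chains of first points, and how they decide the level of a point *)

Section greedy_chain.
Variables (R : realType) (r : R) (X : {fset circle R}) (o : circle R) (u0 : R).
Local Notation p := (window_point r o).

(** The state at offset [cur] of a reader starting in window [s]: it has moved at [g 1, ..., g n],
    and the last clause says that it is still waiting. For [s = 1] the value [g j] is the a_j of the
    overview; for [s = 0] the index is shifted by one, [g j.+1] being b_j. *)
Definition greedy_chain (s n : nat) (g : nat -> R) (cur : R) : Prop :=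
  [/\ g 0 = u0,
      forall l, (l < n)%N -> [/\ g l < g l.+1, p (s + l) (g l.+1) \in X &
         forall v, g l < v < g l.+1 -> p (s + l) v \notin X],
      g n <= cur & forall v, g n < v <= cur -> p (s + n) v \notin X].

Lemma greedy_chain_le s n g cur l : greedy_chain s n g cur -> (l <= n)%N ->
  u0 <= g l <= cur.
Proof.
move=> [g0 gS gn _] ln; apply/andP; split.
  elim: l ln => [|l IHl] ln; first by rewrite g0.
  by have [lt_g _ _] := gS _ ln; rewrite (le_trans (IHl (ltnW ln))) ?ltW.
apply: le_trans gn; rewrite -(subnKC ln).
have : (l + (n - l) <= n)%N by lia.
elim: (n - l)%N => [|k IHk] lk; first by rewrite addn0.
have lk' : (l + k < n)%N by lia.
have [lt_g _ _] := gS _ lk'.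
by rewrite addnS (le_trans (IHk _)) ?ltW//; lia.
Qed.

Lemma greedy_chain_step s n g cur cur' (c : bool) :
  greedy_chain s n g cur -> cur < cur' ->
  (forall v, cur < v < cur' -> p (s + n) v \notin X) ->
  (p (s + n) cur' \in X) = c ->
  exists g', [/\ forall l, (l <= n)%N -> g' l = g l,
    greedy_chain s (n + c) g' cur' & c -> g' n.+1 = cur'].
Proof.
move=> [g0 gS gn gcur] cc' gap; case: c => Xc'.
  exists (fun l => if (l <= n)%N then g l else cur').
  split=> [l -> //| |_]; last by rewrite ltnn.
  rewrite addn1; split=> //; last 2 first.
  - by rewrite ltnn.
  - by move=> v; rewrite ltnn => /andP[/lt_le_trans h /h]; rewrite ltxx.
  move=> l; rewrite ltnS => ln; rewrite ln.
  case: ltnP => [ln'|nl]; first exact: gS.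
  have -> : l = n by apply/eqP; rewrite eqn_leq ln.
  split=> //; first exact: le_lt_trans cc'.
  move=> v /andP[gv vc'].
  have [vc|cv] := leP v cur; first by apply: gcur; rewrite gv.
  by apply: gap; rewrite cv.
exists g; split=> //; rewrite addn0; split=> //.
  by rewrite (le_trans gn)// ltW.
move=> v /andP[gv]; rewrite le_eqVlt => /predU1P[->|vc'].
  by rewrite Xc'.
have [vc|cv] := leP v cur; first by apply: gcur; rewrite gv.
by apply: gap; rewrite cv.
Qed.

End greedy_chain.

Section reading.
Variables (R : realType) (r : R) (X : {fset circle R}) (o : circle R).
Hypotheses (r_gt0 : 0 < r) (r_le1 : r <= 1).
Variables (u0 eps : R).
Hypotheses (u0_ge0 : 0 <= u0) (eps_le : eps <= r).
Local Notation f := (furthest_map X r).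
Local Notation p := (window_point r o).
Let x := p 0 u0.
Hypothesis xX : x \in X.

Local Notation greedy_chain := (greedy_chain r X o u0).
Variables (A B : nat) (a b : nat -> R) (cur : R).
Hypotheses (cur_lt : cur < eps) (chain_a : greedy_chain 1 A a cur)
  (chain_b : greedy_chain 0 B b cur).

(** Induction from [f y] to [y]: the gaps of the chain [a] raise the lower bound for [f y] to [a k],
    and [b k.+1], a later point of the same window, bounds [y] through [furthest_map_backward]. *)
Lemma preimage_between k y : (k <= B)%N -> (k <= A.+1)%N -> y \in X ->
  iter k f y = x ->
  if k is k'.+1 then exists2 u, a k' < u <= b k & y = p k u else y = x.
Proof.
move: r_gt0 r_le1 u0_ge0 eps_le cur_lt => r0 r1 u00 er ce.
have [a0 aS _ _] := chain_a; have [b0 bS _ _] := chain_b.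
elim: k y => [//|k IHk] y kB kA yX; rewrite iterSr => /IHk.
move=> /(_ (ltnW kB) (ltnW kA) (furthest_map_in r_gt0 r_le1 yX)) IH.
have [b_lt bX _] := bS _ kB.
have [v [av vb fy]] : exists v, [/\ a k <= v, v < b k.+1 & f y = p k v].
  case: k {IHk} kB kA IH b_lt bX => [|k] kB kA.
    by move=> fy b_lt bX; exists u0; rewrite a0 -[X in X < _]b0.
  move=> [v /andP[av vb] fy] b_lt bX; exists v; split=> //.
    have [_ _ gap] := aS k kA.
    rewrite leNgt; apply/negP => va; have := gap v; rewrite av va => /(_ isT).
    by rewrite add1n -fy (furthest_map_in r_gt0 r_le1 yX).
  exact: le_lt_trans b_lt.
have /andP[ua _] : u0 <= a k <= cur by apply: (greedy_chain_le chain_a).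
have /andP[_ bc] := greedy_chain_le chain_b kB.
have [|u /andP[vu ub] ->] := furthest_map_backward r_gt0 r_le1 vb _ bX yX fy.
  by lra.
by exists u => //; rewrite ub andbT; lra.
Qed.

(** By [furthest_map_forward] the image of [p k.+1 u] has an offset between [a k] and [u]. It also
    precedes [b k.+1], since otherwise [u] would lie in a gap of the chain [b]. *)
Lemma iter_between k u : (k <= A)%N -> p k u \in X -> a k <= u -> u <= cur ->
  ((k < B)%N -> u < b k.+1) -> iter k f (p k u) = x.
Proof.
move: r_gt0 r_le1 u0_ge0 eps_le cur_lt => r0 r1 u00 er ce.
have [a0 aS _ _] := chain_a; have [b0 bS _ gapB] := chain_b.
elim: k u => [|k IHk] u kA uX au uc ub /=.
  rewrite /x; congr p; apply/eqP; rewrite eq_le -{2}a0 au andbT leNgt.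
  apply/negP => u0u; move: uX; apply/negP.
  have [B0|B0] := posnP B.
    by move: gapB; rewrite B0; apply; rewrite b0 u0u.
  by have [_ _] := bS _ B0; apply; rewrite b0 u0u ub.
have [a_lt _ _] := aS _ kA.
have akX : p k (a k) \in X.
  by move: kA; case: (k) => [|k'] kA; [rewrite a0 | have [] := aS k' (ltnW kA)].
have a_u : a k < u by apply: lt_le_trans au.
have /andP[ua _] : u0 <= a k <= cur.
  by apply: (greedy_chain_le chain_a); apply: ltnW.
have [|v /andP[av vu] fu] := furthest_map_forward r_gt0 r_le1 a_u _ akX uX.
  by lra.
rewrite -iterS iterSr fu; apply: IHk => //; first exact: ltnW.
- by rewrite -fu; apply: furthest_map_in.
- by apply: ltW; apply: lt_le_trans uc.
move=> kB; rewrite ltNge; apply/negP => bv; move: uX; apply/negP.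
have bu : b k.+1 < u by apply: le_lt_trans vu.
have [kB'|Bk] := ltnP k.+1 B.
  by have [_ _] := bS _ kB'; apply; rewrite bu ub.
have BE : B = k.+1 by apply/eqP; rewrite eqn_leq Bk.
by move: gapB; rewrite BE; apply; rewrite bu.
Qed.

End reading.

Section reading_level.
Variables (R : realType) (r : R) (X : {fset circle R}) (o : circle R).
Hypotheses (r_gt0 : 0 < r) (r_le1 : r <= 1).
Variables (u0 eps : R).
Hypotheses (u0_ge0 : 0 <= u0) (eps_le : eps <= r).
Local Notation f := (furthest_map X r).
Local Notation p := (window_point r o).
Let x := p 0 u0.
Hypothesis xX : x \in X.
Variables (m i : nat).

(** Induction on the events [tl] after [cur]. While undecided, [B <= A <= i] and [a l < b l.+1]; the
    latter says that no preimage found so far is empty. The letter 0 paired with [cur] is a dummy,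
    as [path] compares offsets only. *)
Lemma read_level_aux (tl : seq (R * nat)) A B a b cur :
  (B <= A)%N -> (A <= i)%N -> cur < eps ->
  greedy_chain r X o u0 1 A a cur -> greedy_chain r X o u0 0 B b cur ->
  (forall l, (l < B)%N -> a l < b l.+1) ->
  path (fun e e' : R * nat => e.1 < e'.1) (cur, 0) tl ->
  (forall e, e \in tl -> e.1 < eps) ->
  (forall j v, (j <= i.+1)%N -> cur < v < eps ->
     (p j v \in X) = ((v, j %% m)%N \in tl)) ->
  let st := read m i (A.+1, B) (map snd tl) in
  decided i st -> (x \in level_points r X i) = success i st.
Proof.
elim: tl A B a b cur => [|[cur' c] tl IHtl] A B a b cur BA Ai ce ca cb ab /=.
  by move=> _ _ _; rewrite /decided /=; lia.
move=> /andP[cc' ptl] tl_eps XE.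
have c'e : cur' < eps by apply: (tl_eps (cur', c)); rewrite mem_head.
have gt_c' e : e \in tl -> cur' < e.1.
  have tr : transitive (fun e e' : R * nat => e.1 < e'.1).
    by move=> e1 e2 e3; apply: lt_trans.
  by move: ptl; rewrite path_sortedE// => /andP[/allP h _] /h.
have Xc' j : (j <= i.+1)%N -> (p j cur' \in X) = (j %% m == c)%N.
  move=> ji; rewrite XE// ?cc'// inE xpair_eqE eqxx/=.
  case: eqP => //= _; apply/negP => /gt_c'; rewrite /= ltxx//.
have gap j v : (j <= i.+1)%N -> cur < v < cur' -> p j v \notin X.
  move=> ji /andP[cv vc']; rewrite XE// ?cv ?(lt_trans vc')//.
  rewrite inE xpair_eqE lt_eqF//=; apply/negP => /gt_c' /= /(lt_trans vc').
  by rewrite ltxx.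
have XE' j v : (j <= i.+1)%N -> cur' < v < eps ->
    (p j v \in X) = ((v, j %% m)%N \in tl).
  move=> ji /andP[cv ve]; rewrite XE ?ve ?(lt_trans cc')//.
  by rewrite inE xpair_eqE gt_eqF.
have iA : (1 + A <= i.+1)%N by [].
have iB : (0 + B <= i.+1)%N by clear -BA Ai; lia.
have [a' [a'E ca' a'c]] := greedy_chain_step ca cc'
  (fun v => gap _ v iA) (Xc' _ iA).
have [b' [b'E cb' b'c]] := greedy_chain_step cb cc'
  (fun v => gap _ v iB) (Xc' _ iB).
have AB' : (A.+1 == B) = false by clear -BA; lia.
have -> : read_step m i (A.+1, B) c =
    ((A + (A.+1 %% m == c)).+1, B + (B %% m == c))%N.
  by rewrite /read_step /decided /= AB' ltnS ltnNge Ai.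
rewrite add1n in ca' a'c *; rewrite add0n in cb' b'c *.
move: (A.+1 %% m == c)%N ca' a'c => dA ca' a'c.
move: (B %% m == c)%N cb' b'c => dB cb' b'c.
have ab' l : (l < B + dB)%N -> a' l < b' l.+1.
  move=> lB; have lA : (l <= A)%N by clear -BA lB; lia.
  rewrite a'E//; have [lB'|Bl] := ltnP l B; first by rewrite b'E// ab.
  have dBt : dB by clear -lB Bl; lia.
  have -> : l = B by clear -lB Bl; lia.
  (* The new point of the chain [b'] sits at [cur'], past everything the first reader had found by
     [cur]. *)
  rewrite b'c//; apply: le_lt_trans cc'.
  by have /andP[] := greedy_chain_le ca BA.
have inX k : (k <= A + dA)%N -> p k (a' k) \in X.
  have [a'0 a'S _ _] := ca'.
  case: k => [|k] kA; first by rewrite a'0.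
  by have [] := a'S k kA.
have [a'_le b'_le] : (forall k, (k <= A + dA)%N -> a' k <= cur') /\
    (forall k, (k <= B + dB)%N -> b' k <= cur').
  by split=> k kA; [have /andP[] := greedy_chain_le ca' kA
                   |have /andP[] := greedy_chain_le cb' kA].
(* If the second reader catches up, [a' A] is an [A]-fold preimage of [x], while the interval from
   [a' A] to [b' A.+1], which would hold the next preimages, has no point of window [A.+1]. So [x]
   is at level [A]. *)
have [AB|AB] := eqVneq (A + dA).+1 (B + dB)%N.
  have AE : (A + dA = A)%N by clear -BA AB; lia.
  have BE : (B + dB = A.+1)%N by clear -BA AB; lia.
  move=> dst; rewrite read_decided; last by rewrite /decided /= AB eqxx.
  have xA : x \in fiter_image X r A.
    apply/mem_fiter_image; exists (p A (a' A)); first by rewrite inX ?AE.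
    apply: (iter_between r_gt0 r_le1 u0_ge0 eps_le xX c'e ca' cb') => //.
    - by rewrite AE.
    - by rewrite inX ?AE.
    - by rewrite a'_le ?AE.
    - by move=> _; rewrite ab'// BE.
  have xNA : x \notin fiter_image X r A.+1.
    apply/negP => /mem_fiter_image[y yX yx].
    have := preimage_between r_gt0 r_le1 u0_ge0 eps_le c'e ca' cb' _ _ yX yx.
    rewrite AE BE => /(_ (leqnn _) (leqnn _))[u /andP[au ub] yu].
    have [_ _ _ gapA] := ca'.
    have := gapA u; rewrite AE au (le_trans ub)/=; last by rewrite b'_le ?BE.
    by move=> /(_ isT); rewrite add1n -yu yX.
  rewrite /success /= AE BE andbb eqSS.
  have [AiE|Ai'] := eqVneq A i.
    by rewrite !inE /= xX -AiE xA xNA.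
  apply/negbTE; rewrite !inE /= xX /= negb_and.
  apply/orP; left; apply: contra xNA; apply: fiter_image_le => //.
  by clear -Ai Ai'; lia.
(* If the first reader has found a point of window [i.+1], that point is a preimage of [x] under the
   iterate [i.+1], and [x] is not at level [i]. *)
have [iA'|A'i] := ltnP i (A + dA).
  have AE : (A + dA = i.+1)%N by clear -Ai iA'; lia.
  move=> dst; rewrite read_decided; last by rewrite /decided /= ltnS iA' orbT.
  rewrite /success /= AE (_ : i.+2 == i.+1 = false) /=; last by clear; lia.
  apply/negbTE; rewrite !inE /= xX /= negb_and negbK; apply/orP; right.
  apply/mem_fiter_image; exists (p i.+1 (a' i.+1)); first by rewrite inX ?AE.
  apply: (iter_between r_gt0 r_le1 u0_ge0 eps_le xX c'e ca' cb') => //.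
  - by rewrite inX ?AE.
  - by rewrite a'_le ?AE.
  - by clear -BA Ai; lia.
move=> dst; apply: (IHtl _ _ a' b' cur') => //; first by clear -BA AB; lia.
  by case: (tl) ptl.
by move=> e etl; apply: tl_eps; rewrite inE etl orbT.
Qed.

Lemma read_level (tl : seq (R * nat)) : u0 < eps ->
  path (fun e e' : R * nat => e.1 < e'.1) (u0, 0) tl ->
  (forall e, e \in tl -> e.1 < eps) ->
  (forall j v, (j <= i.+1)%N -> u0 < v < eps ->
     (p j v \in X) = ((v, j %% m)%N \in tl)) ->
  let st := read m i (1, 0) (map snd tl) in
  decided i st -> (x \in level_points r X i) = success i st.
Proof.
move=> ue; apply: (@read_level_aux _ 0 0 (fun=> u0) (fun=> u0)) => //.
  by split=> // v /andP[/lt_le_trans h /h]; rewrite ltxx.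
by split=> // v /andP[/lt_le_trans h /h]; rewrite ltxx.
Qed.

End reading_level.

(** * Walks and Catalan numbers *)

(* Simple walks from [D] that reach 0 for the first time at step [k] and avoid [m]. *)
Fixpoint walks (m k D : nat) : nat :=
  (if k is k'.+1 then
    if (D == 0) || (m <= D) then 0 else walks m k' D.-1 + walks m k' D.+1
  else (D == 0))%N.

Lemma walks_small m k D : (k < D)%N -> walks m k D = 0%N.
Proof.
elim: k D => [|k IHk] D kD /=; first by case: D kD.
by case: ifP => // _; rewrite !IHk//; lia.
Qed.

(** Ballot formula with [b] up-steps, written additively; the factor [(0 < b)] removes the second
    binomial at [b = 0]. The condition [D + b < m] keeps the barrier out of reach. Pascal's rule
    gives the induction; at [D = 1], where the lower neighbour contributes nothing, the symmetry of
    the binomials is used. *)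
Lemma walks_ballot m n D b : (n = D + 2 * b)%N -> (0 < D)%N -> (D + b < m)%N ->
  (walks m n D + (0 < b) * 'C(n.-1, b.-1) = 'C(n.-1, b))%N.
Proof.
elim: n D b => [|n IHn] D b nE D0 Dbm; first by lia.
have -> /= : walks m n.+1 D = (walks m n D.-1 + walks m n D.+1)%N.
  by rewrite /= (_ : (D == 0) || (m <= D) = false)%N//; lia.
case: b nE Dbm => [|b] nE Dbm.
  rewrite mul0n addn0 bin0 [walks m n D.+1]walks_small; last by lia.
  rewrite addn0; have [D1|D1] := eqVneq D 1%N.
    have -> : n = 0%N by lia.
    by rewrite D1.
  by have := IHn D.-1 0%N ltac:(lia) ltac:(lia) ltac:(lia); rewrite bin0; lia.
have := IHn D.+1 b; have [n' n'E] : exists n', n = n'.+1 by exists n.-1; lia.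
move=> /(_ ltac:(lia) isT ltac:(lia)).
have [D1|D1] := eqVneq D 1%N; last first.
  have := IHn D.-1 b.+1 ltac:(lia) ltac:(lia) ltac:(lia).
  rewrite n'E /= !mul1n binS.
  by case: (b) => [|b']; rewrite ?bin0 ?bin1 ?binS/=; lia.
rewrite D1 n'E /= mul1n binS.
have := @bin_sub n' b; rewrite (_ : n' - b = b.+1)%N; last by lia.
move=> /(_ ltac:(lia)).
by case: (b) => [|b']; rewrite ?bin0 ?bin1 ?binS/=; lia.
Qed.

(** From height 1 with [i] up-steps the ballot formula gives C(2i, i) - C(2i, i - 1), which is the
    Catalan number. *)
Lemma walks_catalan (R : realType) m i : (i.+1 < m)%N ->
  (walks m (2 * i).+1 1)%:R = catalan R i.
Proof.
move=> im; have := @walks_ballot m (2 * i).+1 1 i ltac:(lia) isT ltac:(lia).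
move=> wE; rewrite /catalan.
have i0 : i.+1%:R != 0 :> R by rewrite pnatr_eq0.
apply: (mulIf i0); rewrite divfK// -natrM; congr _%:R.
move: (walks _ _ _) wE => w /=.
case: (i) => [|j] /=; first by rewrite mul0n bin0; lia.
have := mul_bin_left (2 * j.+1) j; rewrite (_ : 2 * j.+1 - j = j.+2)%N; last by lia.
by rewrite mul1n; nia.
Qed.

Fixpoint bounded_path (h y : int) (s : seq bool) : bool :=
  (0 <= y <= h) &&
  (if s is b :: s' then bounded_path h (y + (if b then 1 else -1)) s' else y == 0).

Lemma path_height_cons b s :
  path_height (b :: s) = (if b then 1 else -1) + path_height s.
Proof. by rewrite /path_height /=; case: b => /=; lia. Qed.

Lemma bounded_pathE h y s : bounded_path h y s =
  (y + path_height s == 0) &&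
  [forall k : 'I_(size s).+1, 0 <= y + path_height (take k s) <= h].
Proof.
have height0 : path_height [::] = 0 by [].
elim: s y => [|b s IHs] y /=.
  rewrite height0 addr0 andbC; congr (_ && _); apply/idP/forallP.
    by [].
  by move=> /(_ ord0).
rewrite IHs path_height_cons andbCA; congr (_ && _); first by rewrite -(addrA y).
apply/andP/forallP => [[y0 /forallP ys] k|ys].
  case: k => -[|k] kP /=; first by rewrite height0 addr0.
  by rewrite path_height_cons (addrA y); apply: (ys (Ordinal (kP : k < (size s).+1)%N)).
split; first by have := ys ord0; rewrite /= height0 addr0.
apply/forallP => -[k kP].
by have := ys (Ordinal (kP : k.+1 < (size s).+2)%N); rewrite /= path_height_cons (addrA y).
Qed.

Lemma card_tuple_cons (k : nat) (P : pred (seq bool)) :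
  #|[pred s : k.+1.-tuple bool | P s]| =
  (#|[pred s : k.-tuple bool | P (false :: s)]| +
   #|[pred s : k.-tuple bool | P (true :: s)]|)%N.
Proof.
rewrite -!sum1_card.
have bij : bijective (fun bs : bool * k.-tuple bool => cons_tuple bs.1 bs.2).
  exists (fun s : k.+1.-tuple bool => (thead s, [tuple of behead s])).
    by move=> [b s]; rewrite theadE; congr pair; apply: val_inj.
  by move=> s; rewrite /= [RHS]tuple_eta; apply: val_inj.
rewrite (reindex _ (onW_bij _ bij)) /=.
rewrite -(pair_big_dep xpredT (fun b (s : k.-tuple bool) => P (b :: s)) (fun _ _ => 1%N)) /=.
by rewrite big_bool /= addnC.
Qed.

(** A walk first reaching 0 at step [k.+1] ends with a step from 1 to 0. Dropping this step and
    lowering all heights by one turns confinement to [1, m - 1] into confinement to [0, m - 2]. *)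
Lemma card_bounded_path m k (D : nat) :
  #|[pred s : k.-tuple bool | bounded_path (m%:Z - 2) (D%:Z - 1) s]| =
  walks m k.+1 D.
Proof.
elim: k D => [|k IHk] D.
  rewrite -sum1_card (eq_bigl (fun=> (D == 1%N) && (1 < m)%N)); last first.
    by move=> s; rewrite inE tuple0 /=; lia.
  have -> : walks m 1 D = ((D == 1%N) && (1 < m)%N).
    by rewrite /=; case: ifP; lia.
  case: (_ && _); rewrite ?big_pred0_eq// sum1_card card_tuple expn0//.
rewrite card_tuple_cons /=.
have [D0|D0] := boolP ((D == 0) || (m <= D))%N.
  have -> : (0 <= D%:Z - 1 <= m%:Z - 2) = false by lia.
  by rewrite /= !eq_card0.
have -> : (0 <= D%:Z - 1 <= m%:Z - 2) by lia.
rewrite /=.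
have -> : D%:Z - 1 + -1 = D.-1%:Z - 1 by lia.
have -> : D%:Z - 1 + 1 = D.+1%:Z - 1 by lia.
by rewrite !IHk.
Qed.

Lemma walks_bounded_catalan m i :
  walks m (2 * i).+1 1 = bounded_catalan i (m%:Z - 2).
Proof.
rewrite -card_bounded_path /bounded_catalan; apply: eq_card => s.
rewrite !inE bounded_pathE (_ : 1%:Z - 1 = 0)// add0r.
have sE : (count_mem true s + count_mem false s = 2 * i)%N.
  have := count_predC (pred1 true) s; rewrite size_tuple => sE; rewrite -[RHS]sE; congr addn.
  by apply: eq_count => -[].
rewrite andbA size_tuple /path_height.
move: (count_mem true s) (count_mem false s) sE => c c' sE; congr (_ && _).
  by lia.
by apply: eq_forallb => k; rewrite add0r.
Qed.

(** * Reading a random word *)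

Section mean.
Variables (F : realFieldType) (m i : nat).
Hypothesis m_gt0 : (0 < m)%N.
Implicit Types (st : nat * nat) (phi : nat * nat -> F).

(* Expectation of [phi] after [k] independent uniform letters. *)
Fixpoint mean phi (k : nat) st : F :=
  if k is k'.+1 then m%:R^-1 * \sum_(c < m) mean phi k' (read_step m i st c)
  else phi st.

(** An invariant of reading from [(1, 0)]. The difference cannot exceed [m] because at difference
    [m] both readers await the same letter. *)
Definition reachable st : bool :=
  [&& st.2 <= st.1, st.1 <= i.+2, st.2 <= i.+1 & st.1 - st.2 <= m]%N.

(** Success takes exactly [k] single moves, which bring both counters to [i.+1]; the difference must
    first reach 0 at the last of them, avoiding [m]. Each move is fair, whence the power of 2. *)
Definition success_prob st : F :=
  let k := ((i.+1 - st.1) + (i.+1 - st.2))%N in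
  if (i.+1 < st.1)%N then 0 else (walks m k (st.1 - st.2))%:R / 2 ^+ k.

Definition undecided_indicator st : F := (~~ decided i st)%:R.

Definition success_indicator st : F := (success i st)%:R.

Definition potential st : nat :=
  (if decided i st then 0 else (i.+2 - st.1) + (i.+2 - st.2))%N.

Let m_neq0 : m%:R != 0 :> F.
Proof. by rewrite pnatr_eq0 -lt0n. Qed.

Lemma reachable_step st (c : 'I_m) :
  reachable st -> reachable (read_step m i st c).
Proof.
case: st => A B; rewrite /read_step; case: ifP => //=.
rewrite /reachable /decided /= => AB /and4P[BA Ai Bi ABm].
have [D|D] := eqVneq (A - B)%N m.
  have -> : (A %% m = B %% m)%N by rewrite -(modnDl B) -D subnK.
  by move: (_ %% m == _)%N => b; clear -AB BA Ai Bi ABm D; lia.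
move: (A %% m == _)%N (B %% m == _)%N => b b'.
by clear -AB BA Ai Bi ABm D; lia.
Qed.

Lemma mean_const st (x : F) : m%:R^-1 * \sum_(c < m) x = x.
Proof. by rewrite sumr_const card_ord -[x *+ _]mulr_natl mulKf. Qed.

(** For a difference strictly between 0 and [m] just two letters change the state, one for each
    reader, and harmonicity is the recursion of [walks]. At difference [m] both sides vanish. *)
Lemma success_prob_harmonic st : reachable st ->
  m%:R^-1 * \sum_(c < m) success_prob (read_step m i st c) = success_prob st.
Proof.
move=> rst; have [dst|] := boolP (decided i st).
  by under eq_bigr do rewrite /read_step dst; rewrite mean_const.
case: st rst => A B; rewrite /reachable => /and4P[/= BA Ai Bi ABm] dst.
have [{}BA {}Ai] : (B < A)%N /\ (A <= i.+1)%N.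
  by move: dst; rewrite /decided /=; clear -BA Ai; lia.
have [D|D] := eqVneq (A - B)%N m.
  have AmB : (A %% m = B %% m)%N.
    by rewrite -(modnDl B) -D subnK// ltnW.
  have h0 A' B' : (A' - B' = m)%N -> success_prob (A', B') = 0.
    move=> D'; rewrite /success_prob /=; case: ltnP => // A'i.
    have -> : (i.+1 - A' + (i.+1 - B') = (i.+1 - A' + (i.+1 - B')).-1.+1)%N.
      by clear -D' A'i m_gt0; lia.
    by rewrite /= D' leqnn orbT mul0r.
  rewrite [RHS]h0// big1 ?mulr0// => c _.
  by rewrite /read_step (negbTE dst) /= AmB h0// subnDr.
have {D}ABm : (A - B < m)%N by clear -ABm D; lia.
have ABmod : (A %% m == B %% m)%N = false.
  apply/negbTE/eqP => E; have := eqn_mod_dvd m (ltnW BA).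
  by rewrite E eqxx => /esym /dvdn_leq; clear -BA ABm; lia.
pose a := Ordinal (ltn_pmod A m_gt0); pose b := Ordinal (ltn_pmod B m_gt0).
have ba : b != a by rewrite -val_eqE /= eq_sym ABmod.
rewrite (bigD1 a)//= (bigD1 b)//=.
rewrite /read_step (negbTE dst) /= !eqxx ABmod eq_sym ABmod /= !addn0 !addn1.
rewrite (eq_bigr (fun=> success_prob (A, B))); last first.
  move=> c /andP[ca cb]; rewrite -!val_eqE /= in ca cb.
  by rewrite ![_ == (c : nat)]eq_sym (negbTE ca) (negbTE cb) !addn0.
have step : success_prob (A.+1, B) + success_prob (A, B.+1) =
    2 * success_prob (A, B).
  rewrite /success_prob /=.
  have [k kE] : exists k, (i.+1 - A + (i.+1 - B))%N = k.+1.
    by exists ((i.+1 - A + (i.+1 - B)).-1)%N; clear -BA Ai; lia.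
  have -> : (i.+1 < A)%N = false by clear -Ai; lia.
  rewrite kE (_ : i.+1 - A + (i.+1 - B.+1) = k)%N; last by clear -kE BA Ai; lia.
  have -> : walks m k.+1 (A - B) = (walks m k (A - B.+1) + walks m k (A.+1 - B))%N.
    rewrite /= (_ : (_ || _) = false); last by clear -BA ABm; lia.
    by congr (walks _ _ _ + walks _ _ _)%N; clear -BA; lia.
  have two : 2 != 0 :> F by rewrite pnatr_eq0.
  have -> : (if (i.+1 < A.+1)%N then 0 else
      (walks m (i.+1 - A.+1 + (i.+1 - B)) (A.+1 - B))%:R /
      2 ^+ (i.+1 - A.+1 + (i.+1 - B))) = (walks m k (A.+1 - B))%:R / 2 ^+ k :> F.
    (* When [A = i.+1], the cutoff value 0 agrees with the walk count: fewer steps remain than the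
       height to descend. *)
    case: ltnP => iA; last first.
      by congr ((walks _ _ _)%:R / 2 ^+ _); clear -kE iA BA; lia.
    by rewrite walks_small ?mul0r//; clear -kE iA BA; lia.
  by rewrite exprS natrD; field; rewrite expf_neq0.
set S := \sum_(_ < _ | _) _.
have -> : S = (m%:R - 2) * success_prob (A, B).
  have := mean_const (0, 0) (success_prob (A, B)).
  rewrite (bigD1 a)//= (bigD1 b)//= -/S => /(congr1 (fun x => m%:R * x)).
  by rewrite /= mulVKf// mulrBl => <-; ring.
by rewrite addrA step -mulrDl addrC subrK mulKf.
Qed.

Lemma walks_le k D : (walks m k D <= 2 ^ k)%N.
Proof.
elim: k D => [|k IHk] D /=; first by case: (D == 0)%N.
case: ifP => // _; rewrite expnS mul2n -addnn.
by apply: leq_add.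
Qed.

Lemma success_prob_itv st : 0 <= success_prob st <= 1.
Proof.
rewrite /success_prob; case: ifP => _; first by rewrite lexx ler01.
set k := (_ + _)%N; have k0 : 0 < 2 ^+ k :> F by rewrite exprn_gt0.
apply/andP; split; first by rewrite divr_ge0 ?ler0n ?ltW.
rewrite ler_pdivrMr// mul1r -natrX ler_nat.
exact: walks_le.
Qed.

Lemma success_prob_decided st : reachable st -> decided i st ->
  success_prob st = success_indicator st.
Proof.
case: st => A B; rewrite /reachable /decided /= => /and4P[BA Ai Bi _].
rewrite /success_prob /success_indicator /success /=.
case: ltnP => [iA _|Ai'].
  by rewrite (_ : A == i.+1 = false)//; clear -iA; lia.
rewrite orbF => /eqP AB; rewrite -AB subnn andbb.
have [AiE|AiE] := eqVneq A i.+1; first by rewrite AiE subnn /= expr0 divr1.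
have -> : (i.+1 - A + (i.+1 - A) = (i.+1 - A + (i.+1 - A)).-1.+1)%N.
  by clear -AiE Ai'; lia.
by rewrite /= mul0r.
Qed.

(** By harmonicity the mean of [success_prob] does not change under reading. It equals the success
    indicator on decided states and lies in [0, 1] on the others. *)
Lemma success_prob_bounds k st : reachable st ->
  mean success_indicator k st <= success_prob st <=
  mean success_indicator k st + mean undecided_indicator k st.
Proof.
elim: k st => [|k IHk] st rst /=.
  have [dst|dst] := boolP (decided i st).
    by rewrite success_prob_decided// lexx lerDl /undecided_indicator dst /=.
  rewrite /undecided_indicator dst /success_indicator.
  rewrite (_ : success i st = false) ?add0r ?success_prob_itv//.
  apply: contraNF dst; rewrite /success /decided => /andP[/eqP -> /eqP ->].
  by rewrite eqxx.
rewrite -success_prob_harmonic// -mulrDr -big_split /=.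
by rewrite !ler_pM2l ?invr_gt0 ?ltr0n// !ler_sum// => c _;
  have /andP[] := IHk _ (reachable_step c rst).
Qed.

(* A letter awaited by the first search decreases the potential, so the expected
   number of letters read before a decision is bounded by [m * potential st]. *)
Lemma sum_mean_undecided N st :
  \sum_(k < N) mean undecided_indicator k st <= (m * potential st)%:R.
Proof.
elim: N st => [|N IHN] st; first by rewrite big_ord0 ler0n.
rewrite big_ord_recl /=.
rewrite -mulr_sumr exchange_big /=.
have [dst|dst] := boolP (decided i st).
  rewrite /undecided_indicator dst /= add0r.
  under eq_bigr do rewrite /read_step dst.
  by rewrite (mean_const st); apply: IHN.
rewrite /undecided_indicator dst /=.
apply: le_trans (_ : 1 + m%:R^-1 * \sum_(c < m)
    (m * potential (read_step m i st c))%:R <= _).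
  by rewrite lerD2l ler_pM2l ?invr_gt0 ?ltr0n// ler_sum.
under eq_bigr do rewrite natrM.
rewrite -mulr_sumr mulKf// -natr_sum nat1r ler_nat.
pose a := Ordinal (ltn_pmod st.1 m_gt0).
have le_pot (c : 'I_m) : (potential (read_step m i st c) + (c == a) <= potential st)%N.
  rewrite {2}/potential (negbTE dst) /potential /read_step (negbTE dst).
  rewrite -val_eqE /= [_ == (c : nat)]eq_sym.
  have {dst} Ai : (st.1 <= i.+1)%N.
    by move: dst; rewrite /decided negb_or -leqNgt => /andP[].
  by move: (_ == _) => b; case: (decided _ _); case: b; clear -Ai; lia.
have : (\sum_(c < m) (potential (read_step m i st c) + (c == a)) <=
  \sum_(c < m) potential st)%N by apply: leq_sum.
rewrite big_split /= sum_nat_const card_ord.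
have -> : (\sum_(c < m) (c == a) = 1)%N.
  by rewrite (bigD1 a) // eqxx big1 // => c /negbTE ->.
by rewrite addn1.
Qed.

End mean.

(** * Configurations of cells and averaging over letters *)

Section configuration.
Variables (F : realFieldType) (m' M n i : nat).
Local Notation m := m'.+1.
Local Notation config := {ffun 'I_n -> option ('I_m * 'I_M)}.
Local Notation shifts := {ffun 'I_n -> 'I_m}.
Implicit Types (v : config) (s : shifts) (l : 'I_n).

(* [v l] is the letter and the cell of the point [l], or [None] if that point lies in no
   window; [letter] and [rank] then take the junk value 0. *)
Definition letter v l : nat := if v l is Some ck then ck.1 else 0.

Definition rank v l : nat := if v l is Some ck then ck.2 else 0.

Definition in_window v : seq 'I_n :=
  sort (fun l l' => (rank v l <= rank v l')%N) [seq l <- enum 'I_n | v l != None].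

Definition after v l : seq 'I_n := drop (index l (in_window v)).+1 (in_window v).

Definition outcome v l : nat * nat :=
  read m i (1, 0)%N [seq letter v l' | l' <- after v l].

Definition first_window v l : bool := (l \in in_window v) && (letter v l == 0%N).

Definition success_count v : nat :=
  (\sum_(l | first_window v l) success i (outcome v l))%N.

Definition undecided_count v : nat :=
  (\sum_(l | first_window v l) ~~ decided i (outcome v l))%N.

(** Ranks are compared across windows too: two points of equal rank would leave the order of reading
    undetermined. *)
Definition collision_free v : bool :=
  [forall l, forall l', (l != l') ==> (v l != None) ==> (v l' != None) ==>
     (rank v l != rank v l')].

(** Letters are added modulo [m] and ranks are kept, so the letters are randomised while the order
    of reading stays fixed. *)
Definition shift s v : config :=
  [ffun l => if v l is Some ck then Some (ck.1 + s l, ck.2) else None].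

Lemma mem_in_window v l : (l \in in_window v) = (v l != None).
Proof. by rewrite mem_sort mem_filter mem_enum andbT. Qed.

Lemma in_window_uniq v : uniq (in_window v).
Proof. by rewrite sort_uniq filter_uniq// enum_uniq. Qed.

Lemma shift_None s v l : (shift s v l == None) = (v l == None).
Proof. by rewrite ffunE; case: (v l). Qed.

Lemma rank_shift s v : rank (shift s v) = rank v.
Proof. by apply/funext => l; rewrite /rank ffunE; case: (v l). Qed.

Lemma in_window_shift s v : in_window (shift s v) = in_window v.
Proof.
rewrite /in_window rank_shift (eq_filter (a2 := fun l => v l != None))// => l.
by rewrite shift_None.
Qed.

Lemma collision_free_shift s v : collision_free (shift s v) = collision_free v.
Proof.
apply: eq_forallb => l; apply: eq_forallb => l'.
by rewrite !shift_None !rank_shift.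
Qed.

Lemma shift_bij s : bijective (shift s).
Proof.
exists (shift [ffun l => - s l]) => v; apply/ffunP => l; rewrite !ffunE;
  by case: (v l) => [[c k]|] //=; rewrite ?addrK ?addrNK.
Qed.

(* Rotations of the coordinate [l0] permute the index set, and averaging over all of them
   makes that coordinate independent of [G c]. *)
Lemma sum_coordinate l0 (G : 'I_m -> shifts -> F) :
  (forall c s s', (forall l, l != l0 -> s l = s' l) -> G c s = G c s') ->
  \sum_(s : shifts) G (s l0) s = m%:R^-1 * \sum_(s : shifts) \sum_c G c s.
Proof.
move=> GE; pose rot (d : 'I_m) s : {ffun 'I_n -> 'I_m} :=
  [ffun l => if l == l0 then s l + d else s l].
have rot_bij d : bijective (rot d).
  exists (rot (- d)) => s; apply/ffunP => l; rewrite !ffunE;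
    by case: eqP => // _; rewrite ?addrK ?addrNK.
have rotE d : \sum_(s : shifts) G (s l0) s = \sum_(s : shifts) G (s l0 + d) s.
  rewrite (reindex (rot d)) /=; last exact: onW_bij.
  apply: eq_bigr => s _; rewrite ffunE eqxx; apply: GE => l /negbTE ll0.
  by rewrite ffunE ll0.
rewrite [X in _ = _ * X](_ : _ = \sum_(d : 'I_m) \sum_(s : shifts) G (s l0) s).
  by rewrite mean_const.
under [RHS]eq_bigr => d do rewrite (rotE d).
rewrite [RHS]exchange_big /=; apply: eq_bigr => s _.
by rewrite (reindex (fun d => s l0 + d)) //=; apply/onW_bij/(Bijective (addKr _) (addNKr _)).
Qed.

Let letter_shift s v l : v l != None ->
  letter (shift s v) l = inord (letter v l) + s l :> nat.
Proof.
rewrite /letter ffunE; case: (v l) => [[c k]|] //= _.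
by rewrite inord_val.
Qed.

Definition total : F := m%:R ^+ n.

Lemma sum1_shift : \sum_(s : {ffun 'I_n -> 'I_m}) 1 = total.
Proof. by rewrite sumr_const card_ffun !card_ord natrX. Qed.

(** As [ls] has no repetition, the shift of its head does not affect the later letters; summing over
    that shift gives one uniform letter, that is, one step of [mean]. *)
Lemma sum_read_shift (phi : nat * nat -> F) v ls st : uniq ls ->
  {subset ls <= in_window v} ->
  \sum_(s : shifts) phi (read m i st [seq letter (shift s v) l | l <- ls]) =
  total * mean m i phi (size ls) st.
Proof.
elim: ls st => [|l ls IHls] st /=.
  by move=> _ _; rewrite -sum1_shift mulr_suml; under [RHS]eq_bigr do rewrite mul1r.
move=> /andP[lls uls] lsv; have lv : v l != None.
  by rewrite -mem_in_window lsv// mem_head.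
pose G (c : 'I_m) s := phi (read m i
  (read_step m i st (inord (letter v l) + c)%R) [seq letter (shift s v) l | l <- ls]).
rewrite (eq_bigr (fun s => G (s l) s)); last first.
  by move=> s _; rewrite /G letter_shift.
rewrite sum_coordinate; last first.
  move=> c s s' ss'; rewrite /G; congr (phi (read _ _ _ _)); apply/eq_in_map => l' l'ls.
  rewrite /letter !ffunE ss'//; apply: contraNneq lls => <- //.
rewrite exchange_big /= mulrCA; congr (_ * _); rewrite mulr_sumr.
rewrite (reindex (fun c => c - inord (letter v l))) /=; last first.
  by apply/onW_bij/(Bijective (subrK _) (addrK _)).
apply: eq_bigr => c _; rewrite /G addrC subrK; apply: IHls => //.
by move=> l' l'ls; apply: lsv; rewrite inE l'ls orbT.
Qed.

(** The factor 1/m is the chance that [l] falls in window 0: exactly one value of its own shift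
    achieves this, independently of the letters read after it. *)
Lemma sum_outcome_shift (phi : nat * nat -> F) v l : l \in in_window v ->
  \sum_(s : shifts) (if first_window (shift s v) l then phi (outcome (shift s v) l) else 0) =
  total / m%:R * mean m i phi (size (after v l)) (1, 0)%N.
Proof.
move=> lv; have lv' : v l != None by rewrite -mem_in_window.
have uls : uniq (l :: after v l).
  have := in_window_uniq v; rewrite -{1}(cat_take_drop (index l (in_window v)) (in_window v)).
  rewrite cat_uniq => /and3P[_ _]; rewrite (drop_nth l) ?index_mem//.
  by rewrite nth_index.
pose G (c : 'I_m) s : F := if inord (letter v l) + c == 0 then
  phi (read m i (1, 0)%N [seq letter (shift s v) l | l <- after v l]) else 0.
rewrite (eq_bigr (fun s => G (s l) s)); last first.
  move=> s _; rewrite /G /first_window in_window_shift lv /=.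
  by rewrite letter_shift// /outcome /after in_window_shift.
rewrite sum_coordinate; last first.
  move=> c s s' ss'; rewrite /G; case: ifP => // _.
  congr (phi (read _ _ _ _)); apply/eq_in_map => l' l'ls.
  rewrite /letter !ffunE ss'//; apply: contraTneq uls => ll'.
  by move: l'ls; rewrite ll' /= => ->.
rewrite mulrAC mulrC; congr (_ * _).
rewrite exchange_big (bigD1 (- inord (letter v l))) //= [X in _ + X]big1 ?addr0; last first.
  move=> c cv; apply: big1 => s _; rewrite /G addrC addr_eq0 (negbTE cv)//.
rewrite /G; under eq_bigr do rewrite subrr eqxx.
move: uls => /= /andP[_ uls]; rewrite (sum_read_shift _ _ uls)//.
by move=> l'; apply: mem_drop.
Qed.

(** Going backwards through the sorted list, the number of points still to be read takes each value
    below its size exactly once. *)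
Lemma sum_after (f : nat -> F) v :
  \sum_(l | l \in in_window v) f (size (after v l)) =
  \sum_(k < size (in_window v)) f k.
Proof.
set ls := in_window v.
have -> : \sum_(l | l \in ls) f (size (after v l)) =
    \sum_(l <- ls) f (size (after v l)).
  rewrite -big_filter; apply: perm_big; apply: uniq_perm.
  - by rewrite filter_uniq// index_enum_uniq.
  - exact: in_window_uniq.
  - by move=> l; rewrite mem_filter mem_index_enum andbT.
have [/size0nil ->|ls_gt0] := posnP (size ls); first by rewrite big_nil big_ord0.
have [l0 _] : exists l0, l0 \in ls.
  by case: (ls) ls_gt0 => // a s _; exists a; rewrite mem_head.
rewrite (big_nth l0) big_mkord (reindex_inj rev_ord_inj) /=.
apply: eq_bigr => k _; rewrite /after -/ls index_uniq ?in_window_uniq ?size_drop//.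
  by congr f; have := ltn_ord k; lia.
by rewrite ltn_subrL ls_gt0.
Qed.

Lemma sum_count_shift (b : nat * nat -> bool) v :
  \sum_(s : shifts) (\sum_(l | first_window (shift s v) l) b (outcome (shift s v) l))%N%:R =
  total / m%:R * \sum_(k < size (in_window v)) mean m i (fun st => (b st)%:R) k (1, 0)%N
  :> F.
Proof.
under eq_bigr do rewrite natr_sum big_mkcond.
rewrite exchange_big /= (bigID (fun l => l \in in_window v)) /= [X in _ + X]big1.
  rewrite addr0 -(sum_after (fun k => mean m i (fun st => (b st)%:R) k (1, 0)%N)).
  rewrite mulr_sumr; apply: eq_bigr => l lv.
  exact: (sum_outcome_shift (fun st => (b st)%:R) lv).
move=> l lv; apply: big1 => s _.
by rewrite /first_window in_window_shift (negbTE lv).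
Qed.

End configuration.

(** * Expectations over independent cells of equal mass *)

Section weights.
Variables (F : realFieldType) (m' M n i : nat).
Local Notation m := m'.+1.
Local Notation config := {ffun 'I_n -> option ('I_m * 'I_M)}.
Local Notation shifts := {ffun 'I_n -> 'I_m}.
Variables (p : option ('I_m * 'I_M) -> F) (delta : F).
Hypotheses (p_ge0 : forall x, 0 <= p x) (p_sum1 : \sum_x p x = 1).
Hypothesis pE : forall ck, p (Some ck) = delta.
Implicit Types (v : config) (l : 'I_n).

Definition weight v : F := \prod_l p (v l).

Lemma weight_ge0 v : 0 <= weight v.
Proof. exact: prodr_ge0. Qed.

Lemma weight_shift s v : weight (shift s v) = weight v.
Proof.
by apply: eq_bigr => l _; rewrite ffunE; case: (v l) => [ck|]//; rewrite !pE.
Qed.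

Lemma sum_weight_prod (g : 'I_n -> option ('I_m * 'I_M) -> F) :
  \sum_v weight v * \prod_l g l (v l) = \prod_l \sum_x p x * g l x.
Proof. by rewrite bigA_distr_bigA; apply: eq_bigr => v _; rewrite -big_split. Qed.

Lemma sum_weight : \sum_v weight v = 1.
Proof.
rewrite -(bigA_distr_bigA (fun _ => p)) big1// => l _; exact: p_sum1.
Qed.

Lemma sum_weight1 l0 (g : option ('I_m * 'I_M) -> F) :
  \sum_v weight v * g (v l0) = \sum_x p x * g x.
Proof.
have := sum_weight_prod (fun l x => if l == l0 then g x else 1).
rewrite (bigD1 l0)//= eqxx [X in _ * X]big1 ?mulr1; last first.
  by move=> l /negbTE ->; rewrite -[RHS]p_sum1; apply: eq_bigr => x _; rewrite mulr1.
move=> <-; apply: eq_bigr => v _; congr (_ * _).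
by rewrite (bigD1 l0)//= eqxx big1 ?mulr1// => l /negbTE ->.
Qed.

Lemma sum_weight2 l0 l1 (g : option ('I_m * 'I_M) -> F) : l0 != l1 ->
  \sum_v weight v * (g (v l0) * g (v l1)) = (\sum_x p x * g x) ^+ 2.
Proof.
move=> l01; have l10 : l1 != l0 by rewrite eq_sym.
have := sum_weight_prod (fun l x => if (l == l0) || (l == l1) then g x else 1).
rewrite (bigD1 l0)//= (bigD1 l1)//= !eqxx orbT [X in _ * (_ * X)]big1 ?mulr1; last first.
  move=> l /andP[/negbTE -> /negbTE ->].
  by rewrite -[RHS]p_sum1; apply: eq_bigr => x _; rewrite mulr1.
rewrite expr2 => <-; apply: eq_bigr => v _; congr (_ * _).
rewrite (bigD1 l0)//= (bigD1 l1)//= !eqxx orbT big1 ?mulr1//.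
by move=> l /andP[/negbTE -> /negbTE ->].
Qed.

Lemma sum_option_pair (g : option ('I_m * 'I_M) -> F) : g None = 0 ->
  \sum_x p x * g x = delta * \sum_(c < m) \sum_(k < M) g (Some (c, k)).
Proof.
move=> g0; rewrite (bigD1 None)//= g0 mulr0 add0r.
rewrite (reindex_omap Some id) => [|[]//].
rewrite pair_big mulr_sumr; apply: eq_big => [ck|[c k] _]; first exact: eqxx.
by rewrite pE.
Qed.

Lemma size_in_window v : (size (in_window v) = \sum_l (v l != None))%N.
Proof.
rewrite size_sort size_filter -sum1_count big_enum_cond big_mkcond /=.
by apply: eq_bigr => l _; case: (v l).
Qed.

Lemma sum_weight_size :
  \sum_v weight v * (size (in_window v))%:R = n%:R * (m%:R * (M%:R * delta)).
Proof.
under eq_bigr do rewrite size_in_window natr_sum mulr_sumr.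
rewrite exchange_big /= (eq_bigr (fun=> m%:R * (M%:R * delta))).
  by rewrite sumr_const card_ord -[LHS]mulr_natl.
move=> l _; rewrite (sum_weight1 l (fun x => (x != None)%:R)) sum_option_pair//=.
under eq_bigr do rewrite sumr_const card_ord.
by rewrite sumr_const card_ord -[_ *+ m]mulr_natr; ring.
Qed.

(** Union bound over ordered pairs of points and over ranks; a given point has a given rank with
    probability [m * delta]. *)
Lemma sum_weight_collision :
  \sum_v weight v * (~~ collision_free v)%:R <=
  n%:R ^+ 2 * (M%:R * (m%:R * delta) ^+ 2).
Proof.
pose g (k : 'I_M) (x : option ('I_m * 'I_M)) : F :=
  (if x is Some ck then ck.2 == k else false)%:R.
have g_ge0 k x : 0 <= g k x by exact: ler0n.
apply: (@le_trans _ _ (\sum_v weight v * \sum_(l : 'I_n)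
    \sum_(l' | l != l') \sum_k g k (v l) * g k (v l'))).
  apply: ler_sum => v _; apply: ler_wpM2l; first exact: weight_ge0.
  case: (boolP (collision_free v)) => [_|].
    by do 3! (apply: sumr_ge0 => ? _); rewrite mulr_ge0.
  move=> /forallPn[l /forallPn[l']]; rewrite !negb_imply.
  case vl : (v l) => [[c k]|]; last by rewrite /= andbF.
  case vl' : (v l') => [[c' k']|]; last by rewrite /= andbF.
  rewrite /rank vl vl' /= andbT => /andP[ll' /eqP kk'].
  have gk : g k (v l) * g k (v l') = 1.
    by rewrite /g vl vl' /= (val_inj kk') !eqxx mulr1.
  rewrite (bigD1 l)//= (bigD1 l')//= (bigD1 k)//= gk -!addrA lerDl.
  by rewrite !addr_ge0//; do ?(apply: sumr_ge0 => ? _); rewrite ?mulr_ge0.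
under eq_bigr do rewrite mulr_sumr.
rewrite exchange_big /=.
have le1 l l' : l != l' ->
    \sum_v weight v * (\sum_k g k (v l) * g k (v l')) = M%:R * (m%:R * delta) ^+ 2.
  move=> ll'; under eq_bigr do rewrite mulr_sumr.
  rewrite exchange_big /= (eq_bigr (fun=> (m%:R * delta) ^+ 2)).
    by rewrite sumr_const card_ord -[LHS]mulr_natl.
  move=> k _; rewrite (sum_weight2 (g k) ll') sum_option_pair//.
  congr (_ ^+ 2); rewrite mulrC; congr (_ * _).
  under eq_bigr => c _.
    rewrite (bigD1 k)//= /g eqxx big1 ?addr0; last by move=> k' /negbTE ->.
    over.
  by rewrite sumr_const card_ord.
have B_ge0 : 0 <= M%:R * (m%:R * delta) ^+ 2.
  by rewrite mulr_ge0 ?ler0n// sqr_ge0.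
rewrite expr2 -mulrA -[n in n%:R * (_ * _)]card_ord -sumr_const.
rewrite !mulr_suml; apply: ler_sum => l _; rewrite mul1r.
under eq_bigr do rewrite mulr_sumr.
rewrite exchange_big /= -[n in n%:R * _]card_ord -sumr_const mulr_suml.
rewrite [leRHS](bigID (fun l' => l != l')) /=.
apply: le_trans (_ : _ <= \sum_(l' | l != l') 1 * (M%:R * (m%:R * delta) ^+ 2)) _.
  by apply: ler_sum => l' ll'; rewrite le1// mul1r.
by rewrite lerDl sumr_ge0// => l' _; rewrite mul1r.
Qed.

(** All cells have mass [delta], so a shift is a weight-preserving bijection, and an expectation
    equals its average over all shifts. *)
Lemma weight_average (f : config -> F) :
  total F m' n * (\sum_v weight v * f v) =
  \sum_v weight v * \sum_(s : shifts) f (shift s v).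
Proof.
rewrite -sum1_shift mulr_suml; under [RHS]eq_bigr do rewrite mulr_sumr.
rewrite [RHS]exchange_big; apply: eq_bigr => s _; rewrite mul1r.
rewrite (reindex (shift s)) /=; last exact/onW_bij/shift_bij.
by apply: eq_bigr => v _; rewrite weight_shift.
Qed.

Lemma total_gt0 : 0 < total F m' n.
Proof. by rewrite exprn_gt0// ltr0n. Qed.

Lemma sum_weight_count (b : nat * nat -> bool) :
  \sum_v weight v * (if collision_free v then
     (\sum_(l | first_window v l) b (outcome i v l))%N%:R else 0) =
  \sum_v weight v * (if collision_free v then
     m%:R^-1 * \sum_(k < size (in_window v)) mean m i (fun st => (b st)%:R) k (1, 0)%N
     else 0).
Proof.
apply: (mulfI (lt0r_neq0 total_gt0)); rewrite weight_average mulr_sumr.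
apply: eq_bigr => v _; rewrite mulrCA; congr (_ * _).
under eq_bigr do rewrite collision_free_shift.
case: (collision_free v); last by rewrite big1 ?mulr0.
by rewrite sum_count_shift mulrA.
Qed.

(** [h] is the probability of success, [K] bounds the expected number of undecided positions, and
    [err] charges [n] points to each collision. *)
Let h : F := success_prob F m i (1, 0)%N.
Let K : F := (m * potential i (1, 0))%:R.
Let err : F := n%:R * (n%:R ^+ 2 * (M%:R * (m%:R * delta) ^+ 2)).

Let reachable10 : reachable m i (1, 0)%N. Proof. by rewrite /reachable. Qed.

Let sum_success_le N :
  \sum_(k < N) mean m i (success_indicator F i) k (1, 0)%N <= N%:R * h.
Proof.
rewrite -[N in N%:R * _]card_ord -sumr_const mulr_suml; apply: ler_sum => k _.
by rewrite mul1r; have /andP[] := success_prob_bounds F (ltn0Sn m') k reachable10.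
Qed.

Let sum_success_ge N :
  N%:R * h - K <= \sum_(k < N) mean m i (success_indicator F i) k (1, 0)%N.
Proof.
rewrite lerBlDr -[N in N%:R * _]card_ord -sumr_const mulr_suml.
apply: le_trans (_ : _ <= \sum_(k < N) (mean m i (success_indicator F i) k (1, 0)%N +
  mean m i (undecided_indicator F i) k (1, 0)%N)) _.
  apply: ler_sum => k _.
  by rewrite mul1r; have /andP[] := success_prob_bounds F (ltn0Sn m') k reachable10.
rewrite big_split /= lerD2l; exact: sum_mean_undecided.
Qed.

Let size_le v : (size (in_window v))%:R <= n%:R :> F.
Proof.
rewrite ler_nat size_in_window (leq_trans (leq_sum _ (fun l _ => leq_b1 _)))//.
by rewrite sum1_card card_ord.
Qed.

Let m_inv : 0 < (m%:R^-1 : F) <= 1.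
Proof. by rewrite invr_gt0 ltr0n/= invf_le1 ?ltr0n// ler1n. Qed.

Let window_mass : m%:R^-1 * h * (n%:R * (m%:R * (M%:R * delta))) =
  n%:R * (M%:R * delta) * h.
Proof.
have : m%:R != 0 :> F by rewrite pnatr_eq0.
by move: (m%:R : F) => x x0; field.
Qed.

Lemma sum_weight_success_ge :
  n%:R * (M%:R * delta) * h - K - err <=
  \sum_v weight v * (if collision_free v then (success_count i v)%:R else 0).
Proof.
rewrite sum_weight_count.
have K0 : 0 <= K by exact: ler0n.
have h01 : 0 <= h <= 1 by exact: success_prob_itv.
apply: le_trans (_ : _ <= \sum_v (m%:R^-1 * h * (weight v * (size (in_window v))%:R) -
   K * weight v - n%:R * (weight v * (~~ collision_free v)%:R))) _.
  rewrite 2!big_split /= !sumrN -!mulr_sumr sum_weight sum_weight_size mulr1.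
  rewrite window_mass.
  rewrite lerD2l lerN2; apply: ler_wpM2l; first exact: ler0n.
  exact: sum_weight_collision.
apply: ler_sum => v _.
set N := size (in_window v).
rewrite (_ : _ - _ - _ = weight v *
  (m%:R^-1 * h * N%:R - K - n%:R * (~~ collision_free v)%:R)); last by ring.
apply: ler_wpM2l; first exact: weight_ge0.
have := sum_success_ge N; have := size_le v; rewrite -/N => Nn SN.
have := m_inv => /andP[mi0 mi1].
case: (collision_free v).
  rewrite mulr0 subr0; apply: le_trans (_ : m%:R^-1 * (N%:R * h - K) <= _).
    by rewrite mulrBr -mulrA [h * _]mulrC lerD2l lerN2 ler_piMl.
  by rewrite ler_pM2l.
(* On a collision the subtracted [n] outweighs the main term, so the lower bound is at most 0. *)
rewrite mulr1 -addrA -opprD subr_le0.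
apply: le_trans (_ : n%:R <= _); last by rewrite lerDr.
apply: le_trans Nn; rewrite ler_piMl ?ler0n//.
by move: h01 => /andP[h0 h1]; rewrite mulr_ile1// ltW.
Qed.

(** Undecided points are counted as if they succeeded, at a total cost of at most [K], and a
    collision is charged the trivial bound [n]. *)
Lemma sum_weight_success_le :
  \sum_v weight v * (if collision_free v then
    (success_count i v + undecided_count i v)%:R else n%:R) <=
  n%:R * (M%:R * delta) * h + K + err.
Proof.
have K0 : 0 <= K by exact: ler0n.
have h01 : 0 <= h <= 1 by exact: success_prob_itv.
have -> : \sum_v weight v * (if collision_free v then
    (success_count i v + undecided_count i v)%:R else n%:R) =
  \sum_v weight v * (if collision_free v then (success_count i v)%:R else 0) +
  \sum_v weight v * (if collision_free v then (undecided_count i v)%:R else 0) +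
  \sum_v n%:R * (weight v * (~~ collision_free v)%:R).
  rewrite -!big_split /=; apply: eq_bigr => v _.
  by case: ifP => _; rewrite ?natrD /=; ring.
rewrite -mulr_sumr lerD//; last first.
  apply: ler_wpM2l; first exact: ler0n.
  exact: sum_weight_collision.
rewrite (sum_weight_count (success i)) (sum_weight_count (fun st => ~~ decided i st)).
rewrite -big_split /=.
apply: le_trans (_ : _ <= \sum_v (m%:R^-1 * h * (weight v * (size (in_window v))%:R) +
   K * weight v)) _; last first.
  rewrite big_split /= -!mulr_sumr sum_weight sum_weight_size mulr1.
  rewrite window_mass.
  by [].
apply: ler_sum => v _.
set N := size (in_window v).
rewrite (_ : m%:R^-1 * h * _ + _ = weight v * (m%:R^-1 * h * N%:R + K)); last by ring.
rewrite -mulrDr; apply: ler_wpM2l; first exact: weight_ge0.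
have := m_inv => /andP[mi0 mi1]; have /andP[h0 h1] := h01.
case: (collision_free v); last first.
  by rewrite addr0 addr_ge0// !mulr_ge0 ?ler0n// ltW.
rewrite -mulrDr.
apply: le_trans (_ : m%:R^-1 * (N%:R * h + K) <= _).
  rewrite ler_pM2l// lerD//; first exact: sum_success_le.
  exact: (@sum_mean_undecided F m i isT N (1, 0)%N).
by rewrite mulrDr -mulrA [h * _]mulrC lerD2l ler_piMl.
Qed.

End weights.

(** * Cells of the circle *)

Section circle_arcs.
Variable R : realType.
Implicit Types (c : circle R) (a b t : R).

Definition arc c a b : set (circle R) := [set x | a <= clockwise_dist c x < b].

Lemma clockwise_dist_to_circle c t (u := clockwise_dist 0 c) :
  clockwise_dist c (to_circle t) = t - u - (Num.floor (t - u))%:~R.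
Proof.
apply: clockwise_dist_unique.
  have := floor_itv (t - u); rewrite intrD => /andP[? ?]; apply/andP; split; lra.
rewrite to_circle_floor to_circleB -{1}[c](clockwise_distK 0) add0r -/u.
by rewrite addrC subrK.
Qed.

Lemma arc_preimage c a b (u := clockwise_dist 0 c) : 0 <= a -> b <= 1 ->
  @to_circle R @^-1` arc c a b =
  \bigcup_(k : int) `[u + a + k%:~R, u + b + k%:~R[%classic.
Proof.
move=> a0 b1; apply/seteqP; split=> t; rewrite /arc /=.
  rewrite clockwise_dist_to_circle -/u => tab.
  by exists (Num.floor (t - u)) => //=; rewrite in_itv /=; lra.
move=> [k _ /=]; rewrite in_itv /= => tk.
rewrite clockwise_dist_to_circle -/u (_ : Num.floor (t - u) = k); first by lra.
by apply: floor_def; rewrite intrD; lra.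
Qed.

Lemma measurable_arc c a b : 0 <= a -> b <= 1 -> measurable (arc c a b).
Proof.
move=> a0 b1; rewrite /measurable /= /circle_measurable /= arc_preimage//.
by apply: countable_bigcupT_measurable => //; exact: countableP.
Qed.

(** The density of [uniform_prob] lives on the closed interval; removing the null set {1} leaves a
    fundamental domain of the circle. *)
Lemma uniform_prob01 (A : set R) : measurable A ->
  uniform_prob (@ltr01 R) A = lebesgue_measure (A `&` `[0, 1[).
Proof.
move=> mA; rewrite /uniform_prob integral_uniform_pdf.
rewrite (eq_integral (fun=> 1%E)); last first.
  move=> x; rewrite inE/= => -[_]; rewrite in_itv/= /uniform_pdf => ->.
  by rewrite subr0 invr1.
rewrite integral_cst ?mul1e; last exact: measurableI.
rewrite -(@setUitv1 _ _ (BLeft 0) 1 true) ?bnd_simp// setIUr; apply: measureU0.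
- exact: measurableI.
- exact: measurableI.
- apply: (@subset_measure0 _ _ _ lebesgue_measure _ [set 1]) => //.
  + exact: measurableI.
  + exact: lebesgue_measure_set1.
Qed.

Lemma circle_uniform_arc c a b : 0 <= a -> a <= b -> b <= 1 ->
  circle_uniform (arc c a b) = (b - a)%:E.
Proof.
move=> a0 ab b1; rewrite /circle_uniform /pushforward.
rewrite uniform_prob01; last exact: (measurable_arc c a0 b1).
set u := clockwise_dist 0 c.
have u0 : 0 <= u by exact: clockwise_dist_ge0.
have u1 : u < 1 by exact: clockwise_dist_lt1.
(* The lift of the arc meets [0, 1) in a direct piece and a piece wrapped around 1; either may be
   empty. *)
have -> : @to_circle R @^-1` arc c a b `&` `[0, 1[ =
    `[u + a, Num.min (u + b) 1[%classic `|` `[Num.max (u + a - 1) 0, u + b - 1[%classic.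
  apply/seteqP; split=> t; rewrite arc_preimage//= -/u.
    move=> [[k _ /=]]; rewrite !in_itv /= => tk t01.
    have : (-2)%:~R < (k%:~R : R) < 1%:~R by rewrite intrN; lra.
    rewrite !ltr_int => k2; have [k0|k1] : k = 0 \/ k = -1 by lia.
      by left; rewrite lt_min; move: tk; rewrite k0; lra.
    by right; rewrite ge_max; move: tk; rewrite k1 intrN; lra.
  move=> [|]; rewrite !in_itv /= ?lt_min ?ge_max => tI; (split; last by lra).
    by exists 0 => //=; rewrite in_itv /=; lra.
  by exists (-1) => //=; rewrite in_itv /= intrN; lra.
have muU (A B : set R) : measurable A -> measurable B -> A `&` B = set0 ->
    lebesgue_measure (A `|` B) = (lebesgue_measure A + lebesgue_measure B)%E.
  by move=> mA mB AB; rewrite measureU.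
rewrite muU//; last first.
  apply/seteqP; split=> // t [] /=; rewrite !in_itv /= lt_min ge_max; lra.
rewrite !lebesgue_measure_itv /= !lte_fin.
have [ub|ub] := leP (u + b) 1; have [ua|ua] := leP (u + a - 1) 0.
all: repeat case: ifP => ?; rewrite -?EFinD; congr (_%:E); lra.
Qed.

End circle_arcs.

(** * From the cells of the points to their levels *)

Section cells.
Variables (R : realType) (r : R) (o : circle R) (m' M i : nat) (eps delta : R).
Local Notation m := m'.+1.
Local Notation p := (window_point r o).

(* There is at most one such pair, as the windows are disjoint. *)
Definition cell (x : circle R) : option ('I_m * 'I_M) :=
  [pick ck : 'I_m * 'I_M |
    (ck.2)%:R * delta <= clockwise_dist (p ck.1 0) x < (ck.2).+1%:R * delta].

Definition config_of (n : nat) (Xs : 'I_n -> circle R) :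
  {ffun 'I_n -> option ('I_m * 'I_M)} := [ffun l => cell (Xs l)].

Definition arc_level_points (X : {fset circle R}) : {fset circle R} :=
  [fset x in level_points r X i | clockwise_dist o x < eps]%fset.

Hypotheses (r_gt0 : 0 < r) (r_le1 : r <= 1) (eps_le : eps <= r).
Hypotheses (delta_gt0 : 0 < delta) (epsE : eps = M%:R * delta).
Hypothesis window_modn : forall j u, (j <= i.+1)%N -> p j u = p (j %% m)%N u.
Hypothesis window_disjoint : forall (c c' : 'I_m) x,
  clockwise_dist (p c 0) x < eps -> clockwise_dist (p c' 0) x < eps -> c = c'.

Lemma cell_SomeP (ck : 'I_m * 'I_M) x : cell x = Some ck <->
  (ck.2)%:R * delta <= clockwise_dist (p ck.1 0) x < (ck.2).+1%:R * delta.
Proof.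
have small (ck' : 'I_m * 'I_M) t : t < (ck'.2).+1%:R * delta -> t < eps.
  by move/lt_le_trans; apply; rewrite epsE ler_pM2r// ler_nat.
rewrite /cell; case: pickP => [ck' ck'P|/(_ ck)->//].
split=> [[<-]//|ckP]; congr Some.
have c'c : ck'.1 = ck.1.
  by apply: (@window_disjoint _ _ x); [move: ck'P | move: ckP] => /andP[_ /small].
case: ck ck' ckP ck'P c'c => [c k] [c' k'] /= /andP[ckl cku] /andP[ck'l ck'u] c'c.
rewrite c'c in ck'l ck'u *; congr pair; apply: val_inj => /=.
have := le_lt_trans ck'l cku; have := le_lt_trans ckl ck'u.
by rewrite !ltr_pM2r// !ltr_nat !ltnS => ? ?; apply/eqP; rewrite eqn_leq; apply/andP.
Qed.

Lemma window_pointK j x : p j (clockwise_dist (p j 0) x) = x.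
Proof. by rewrite -[X in p _ X]add0r -window_point_shift clockwise_distK. Qed.

Lemma clockwise_dist_window j v : 0 <= v < eps ->
  clockwise_dist (p j 0) (p j v) = v.
Proof.
move=> /andP[v0 ve]; apply: clockwise_dist_unique.
  by rewrite v0 (lt_le_trans ve)// (le_trans eps_le).
by rewrite window_point_shift add0r.
Qed.

Lemma cell_window (c : 'I_m) v : 0 <= v < eps ->
  exists k, cell (p c v) = Some (c, k).
Proof.
move=> ve; have /andP[v0 v_lt] := ve.
have q0 : 0 <= v / delta by rewrite divr_ge0// ltW.
have kM : (Num.truncn (v / delta) < M)%N.
  by rewrite -(ltr_nat R) (@le_lt_trans _ _ (v / delta)) ?truncn_le// ltr_pdivrMr// -epsE.
exists (Ordinal kM); apply/cell_SomeP => /=; rewrite clockwise_dist_window//.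
by rewrite -ler_pdivlMr// -ltr_pdivrMr// truncn_itv.
Qed.

Variables (n : nat) (Xs : 'I_n -> circle R).
Let X : {fset circle R} := [fset Xs l | l in 'I_n]%fset.
Let v := config_of Xs.
Let offset l : R := clockwise_dist (p (letter v l) 0) (Xs l).

Let Xs_in l : Xs l \in X.
Proof. by apply/imfsetP; exists l. Qed.

Let XsE l : Xs l = p (letter v l) (offset l).
Proof. by rewrite window_pointK. Qed.

Let offset_itv l : l \in in_window v ->
  (rank v l)%:R * delta <= offset l < (rank v l).+1%:R * delta /\ offset l < eps.
Proof.
rewrite mem_in_window /offset /rank /letter ffunE; case E : (cell _) => [ck|]// _.
have /cell_SomeP ckP := E; split=> //; have /andP[_ lt1] := ckP.
by apply: lt_le_trans lt1 _; rewrite epsE ler_pM2r// ler_nat.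
Qed.

Let offset_ge0 l : 0 <= offset l. Proof. exact: clockwise_dist_ge0. Qed.

Let rank_offset l l' : l \in in_window v -> l' \in in_window v ->
  (rank v l < rank v l')%N -> offset l < offset l'.
Proof.
move=> /offset_itv[/andP[_ lu] _] /offset_itv[/andP[l'l _] _] ll'.
by apply: lt_le_trans lu _; apply: le_trans l'l; rewrite ler_pM2r// ler_nat.
Qed.

Lemma in_window_sorted : collision_free v ->
  sorted (fun l l' => rank v l < rank v l')%N (in_window v).
Proof.
move=> cf; have tr : transitive (fun l l' : 'I_n => rank v l <= rank v l')%N.
  by move=> ? ? ?; apply: leq_trans.
have : sorted (fun l l' => rank v l <= rank v l')%N (in_window v).
  by apply: sort_sorted => l l'; apply: leq_total.
have := in_window_uniq v; have : {subset in_window v <= in_window v} by [].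
elim: {1 3 4 5}(in_window v) => //= l ls IHls sub /andP[lls uls].
have tr' : transitive (fun l l' : 'I_n => rank v l < rank v l')%N.
  by move=> ? ? ?; apply: ltn_trans.
rewrite (path_sortedE tr) (path_sortedE tr') => /andP[/allP le_l sls].
rewrite IHls// ?andbT; last first.
  by move=> l' l'ls; apply: sub; rewrite inE l'ls orbT.
apply/allP => l' l'ls; rewrite ltn_neqAle le_l// andbT.
have := cf => /forallP/(_ l)/forallP/(_ l').
rewrite -!mem_in_window !sub ?inE ?l'ls ?orbT ?eqxx//=.
by move/implyP; apply; apply: contraNneq lls => ->.
Qed.

Let after_path l : collision_free v -> l \in in_window v ->
  path (fun l l' => rank v l < rank v l')%N l (after v l).
Proof.
move=> cf lv; have := in_window_sorted cf.
rewrite -[X in sorted _ X](cat_take_drop (index l (in_window v))).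
rewrite (drop_nth l) ?index_mem// nth_index//.
case: (take _ _) => [|a t] //=.
by rewrite cat_path => /andP[_ /=] /andP[_].
Qed.

Let mem_after l l' : collision_free v -> l \in in_window v ->
  (l' \in after v l) = (l' \in in_window v) && (rank v l < rank v l')%N.
Proof.
move=> cf lv; have tr : transitive (fun l l' : 'I_n => rank v l < rank v l')%N.
  by move=> ? ? ?; apply: ltn_trans.
apply/idP/andP => [l'a|[l'v ll']].
  split; first exact: mem_drop l'a.
  by have := after_path cf lv; rewrite path_sortedE// => /andP[/allP + _]; apply.
have := l'v; rewrite -{1}[in_window v](cat_take_drop (index l (in_window v))).
rewrite (drop_nth l) ?index_mem// nth_index// mem_cat inE.
move=> /orP[l't|/predU1P[l'l|//]]; last by rewrite l'l ltnn in ll'.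
have := in_window_sorted cf.
rewrite -[X in sorted _ X](cat_take_drop (index l (in_window v))).
rewrite (drop_nth l) ?index_mem// nth_index//.
rewrite (sorted_pairwise tr) pairwise_cat => /andP[/allrelP h _].
have := h l' l l't; rewrite inE eqxx => /(_ isT).
by rewrite ltnNge (ltnW ll').
Qed.

(** Without collisions the order of ranks is the order of offsets, so the points of [after v l],
    with their offsets and letters, form an event list to which [read_level] applies. *)
Lemma read_level_config l : collision_free v -> first_window v l ->
  decided i (outcome i v l) ->
  (Xs l \in level_points r X i) = success i (outcome i v l).
Proof.
move=> cf /andP[lv /eqP l0].
have [/andP[_ _] l_eps] := offset_itv lv.
pose tl := [seq (offset l', letter v l') | l' <- after v l].
have wE : [seq letter v l' | l' <- after v l] = map snd tl.
  by rewrite -map_comp.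
rewrite /outcome wE XsE l0.
apply: (read_level r_gt0 r_le1 (offset_ge0 l) eps_le _ l_eps).
- by rewrite -[X in p X]l0 -XsE Xs_in.
- have := after_path cf lv; have : {subset l :: after v l <= in_window v}.
    move=> l'; rewrite inE => /predU1P[->//|]; exact: mem_drop.
  rewrite /tl; move: (after v l) => ls0; elim: ls0 (l) => //= l1 ls IHls l2 sub /andP[r12 pls].
  apply/andP; split.
    by apply: rank_offset => //; apply: sub; rewrite !inE eqxx ?orbT.
  (* Only offsets are compared, so the letter of the first pair can be replaced by 0 to fit the
     induction hypothesis. *)
  have := IHls l1; rewrite (_ : path _ (offset l1, letter v l1) _ =
      path (fun e e' : R * nat => e.1 < e'.1) (offset l1, 0)
           [seq (offset l', letter v l') | l' <- ls]); last by case: (ls).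
  by apply=> // l' l'ls; apply: sub; rewrite inE l'ls orbT.
- by move=> e /mapP[l' /mem_drop l'v ->] /=; have [] := offset_itv l'v.
move=> j u ji /andP[lu ue].
have ju : (j %% m < m)%N by rewrite ltn_mod.
apply/imfsetP/mapP => [[l' _ /= uX]|[l' l'a [uE jE]]].
  rewrite window_modn// in uX.
  have u0e : 0 <= u < eps by rewrite ue andbT ltW// (le_lt_trans (offset_ge0 l)).
  have [k cellE] := cell_window (Ordinal ju) u0e.
  rewrite /= uX in cellE.
  have l'v : l' \in in_window v by rewrite mem_in_window ffunE cellE.
  have jE : letter v l' = (j %% m)%N by rewrite /letter ffunE cellE.
  have uE : offset l' = u by rewrite /offset jE -uX clockwise_dist_window.
  exists l'; last by rewrite uE jE.
  (* A rank of [l'] below that of [l] would reverse the offsets, and an equal rank forces [l' = l]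
     for lack of collisions. *)
  rewrite mem_after// l'v /= ltnNge; apply/negP.
  rewrite leq_eqVlt => /predU1P[rE|/(rank_offset l'v lv)]; last first.
    by rewrite uE ltNge (ltW lu).
  have := cf => /forallP/(_ l')/forallP/(_ l); rewrite -!mem_in_window l'v lv rE eqxx.
  rewrite implybF negbK => /eqP ll'; by rewrite -uE ll' ltxx in lu.
exists l' => //=; rewrite window_modn// uE jE; exact/esym/XsE.
Qed.

Let p00 : p 0 0 = o. Proof. by rewrite /window_point mul0r subr0 to_circle0 addr0. Qed.

Let first_windowE l : first_window v l = (clockwise_dist o (Xs l) < eps).
Proof.
apply/andP/idP => [[lv /eqP l0]|l_eps].
  by have [_] := offset_itv lv; rewrite /offset l0 p00.
have [|k cellE] := @cell_window ord0 (clockwise_dist o (Xs l)).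
  by rewrite clockwise_dist_ge0.
have := window_pointK 0 (Xs l); rewrite p00 => pX; rewrite /= pX in cellE.
by rewrite mem_in_window /letter ffunE cellE.
Qed.

Let card_pred_sum (b : pred 'I_n) :
  (\sum_(l | first_window v l) b l = #|[pred l | first_window v l && b l]|)%N.
Proof.
rewrite -sum1_card /= big_mkcond [RHS]big_mkcond /=.
by apply: eq_bigr => l _; rewrite inE; case: first_window; case: (b l).
Qed.

(** Two indices with the same point in a window would have equal ranks, so without collisions the
    counted indices give distinct points. *)
Lemma success_count_le : collision_free v ->
  (success_count i v <= #|` arc_level_points X|)%N.
Proof.
move=> cf; rewrite /success_count card_pred_sum; set S := [pred l | _].
have -> : #|S| = #|` [fset Xs l | l in S]%fset|.
  rewrite card_in_imfset /=; first by rewrite -cardE.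
  move=> l l' lS l'S XE.
  have /andP[/andP[lv _] _] : first_window v l && success i (outcome i v l) := lS.
  have /andP[/andP[l'v _] _] : first_window v l' && success i (outcome i v l') := l'S.
  apply/eqP; apply: contraTT cf => ll'; apply/forallPn; exists l.
  apply/forallPn; exists l'; rewrite !negb_imply ll' -!mem_in_window lv l'v /=.
  by rewrite /rank !ffunE XE eqxx.
apply: fsubset_leq_card; apply/fsubsetP => x /imfsetP[l /= lS ->].
have /andP[fl sl] : first_window v l && success i (outcome i v l) := lS.
rewrite !inE -first_windowE fl andbT.
have dl : decided i (outcome i v l).
  by move: sl; rewrite /success /decided => /andP[/eqP -> /eqP ->]; rewrite eqxx.
by have := read_level_config cf fl dl; rewrite !inE /= sl.
Qed.

Lemma arc_level_points_le : (#|` arc_level_points X| <=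
  if collision_free v then success_count i v + undecided_count i v else n)%N.
Proof.
have subX : {subset arc_level_points X <= X}.
  by move=> x; rewrite !inE => /andP[/andP[]].
case: ifP => [cf|_].
  rewrite /success_count /undecided_count !card_pred_sum -cardUI.
  apply: leq_trans (leq_addr _ _); set S := predU _ _.
  apply: (@leq_trans #|` [fset Xs l | l in S]%fset|); last first.
    by rewrite (leq_trans (leq_imfset_card _ _ _))// -cardE.
  apply: fsubset_leq_card; apply/fsubsetP => x xA.
  have /imfsetP[l _ xE] := subX _ xA; rewrite xE in xA *.
  apply/imfsetP; exists l => //=; rewrite inE /= !inE.
  move: xA; rewrite !inE -first_windowE => /andP[xl fl]; rewrite fl /=.
  have [dl|//] := boolP (decided i (outcome i v l)); last by rewrite orbT.
  by rewrite -(read_level_config cf fl dl) !inE xl.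
apply: (@leq_trans #|` X|); first by apply: fsubset_leq_card; apply/fsubsetP.
by rewrite (leq_trans (leq_imfset_card _ _ _))//= -cardE card_ord.
Qed.

End cells.

(** * Expectation *)

Section finite_valued.
Context d (T : measurableType d) (R : realType) (P : probability T R).

(* As the integral of a nonnegative function is a supremum over the simple functions
   below it, neither function needs to be measurable. *)
Lemma ge0_le_integral_nonmeasurable (f g : T -> \bar R) :
  (forall x, 0 <= f x)%E -> (forall x, f x <= g x)%E ->
  (\int[P]_x f x <= \int[P]_x g x)%E.
Proof.
move=> f0 fg; have g0 x : (0 <= g x)%E by exact: le_trans (fg x).
rewrite !ge0_integralTE//; apply: le_ereal_sup => _ [h /= hf <-].
by exists h => //= x; apply: le_trans (fg x).
Qed.

Variables (K : finType) (f : T -> K).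
Hypothesis mf : forall k, measurable (f @^-1` [set k]).

Lemma measurable_finite_valued (G : K -> R) :
  measurable_fun setT (fun w => (G (f w))%:E).
Proof.
move=> _ Y mY; rewrite setTI.
rewrite (_ : _ @^-1` Y = \bigcup_(k in [set k | Y (G k)%:E]) (f @^-1` [set k])).
  by apply: fin_bigcup_measurable.
by apply/seteqP; split=> w /=; [exists (f w)|move=> [k Yk /= ->]].
Qed.

Lemma integral_finite_valued (G : K -> R) : (forall k, 0 <= G k) ->
  (\int[P]_w (G (f w))%:E = (\sum_k fine (P (f @^-1` [set k])) * G k)%:E)%E.
Proof.
move=> G0; pose F k w : \bar R := ((G k)%:E * (\1_(f @^-1` [set k]) w)%:E)%E.
rewrite (eq_integral (fun w => (\sum_(k <- index_enum K) F k w)%E)); last first.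
  move=> w _; rewrite (bigD1 (f w))//= [X in (_ + X)%E]big1 ?adde0.
    by rewrite /F indicE mem_set//= mule1.
  move=> k kf; rewrite /F indicE memNset ?mule0//= => fk.
  by rewrite fk eqxx in kf.
rewrite ge0_integral_sum//; last 2 first.
- by move=> k; apply: measurable_funeM; apply/measurable_EFinP/measurable_indic.
- by move=> k w _; rewrite /F mule_ge0// lee_fin.
rewrite -sumEFin; apply: eq_bigr => k _.
rewrite ge0_integralZl_EFin//; last by apply/measurable_EFinP/measurable_indic.
rewrite integral_indic// setIT muleC EFinM fineK//.
exact: fin_num_measure.
Qed.

Lemma sum_finite_valued : \sum_k fine (P (f @^-1` [set k])) = 1.
Proof.
have := @integral_finite_valued (fun=> 1) (fun=> ler01).
rewrite integral_cst// [X in (_ * X)%E]probability_setT mule1 => -[->].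
by apply: eq_bigr => k _; rewrite mulr1.
Qed.

End finite_valued.

(** * Bounds on the expected number of points at a level *)

Section expected_level.
Variables (R : realType) (r : R) (m' i L M n : nat).
Local Notation m := m'.+1.
Local Notation eps := (L%:R^-1 : R).
Local Notation delta := (eps / M%:R : R).
Local Notation origin a := (to_circle (a%:R * eps)).
Hypotheses (r_gt0 : 0 < r) (r_le1 : r <= 1) (eps_le : eps <= r).
Hypotheses (L_gt0 : (0 < L)%N) (M_gt0 : (0 < M)%N).
Hypothesis window_modn : forall o j u, (j <= i.+1)%N ->
  window_point r o j u = window_point r o (j %% m)%N u.
Hypothesis window_disjoint : forall o (c c' : 'I_m) x,
  clockwise_dist (window_point r o c 0) x < eps ->
  clockwise_dist (window_point r o c' 0) x < eps -> c = c'.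

Let eps_gt0 : 0 < eps. Proof. by rewrite invr_gt0 ltr0n. Qed.

Let delta_gt0 : 0 < delta. Proof. by rewrite divr_gt0 ?ltr0n. Qed.

Let epsE : eps = M%:R * delta.
Proof. by rewrite mulrC divfK// pnatr_eq0 -lt0n. Qed.

Let eps_le1 : eps <= 1.
Proof. by rewrite invf_le1 ?ltr0n// ler1n. Qed.

Lemma clockwise_dist_origin (a : 'I_L) x :
  (clockwise_dist (origin a) x < eps) =
  (a%:R * eps <= clockwise_dist 0 x < a.+1%:R * eps).
Proof.
have L0 : 0 < L%:R :> R by rewrite ltr0n.
have e0 := eps_gt0; have e1 : L%:R * eps = 1 by rewrite divff// gt_eqF.
have a0 : 0 <= a%:R * eps by rewrite mulr_ge0// ltW.
have a1 : a.+1%:R * eps <= 1 by rewrite -[leRHS]e1 ler_pM2r// ler_nat.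
rewrite -natr1 mulrDl mul1r in a1 *.
have uE : clockwise_dist 0 (origin a) = a%:R * eps.
  by apply: clockwise_dist_unique; rewrite ?add0r//; lra.
set t := clockwise_dist 0 x.
have t01 : 0 <= t < 1 by rewrite clockwise_dist_ge0 clockwise_dist_lt1.
have xE : x = to_circle t by rewrite -[LHS](clockwise_distK 0) add0r.
rewrite [in LHS]xE clockwise_dist_to_circle uE.
move: (floor_itv (t - a%:R * eps)); set k := Num.floor _; clearbody k; rewrite intrD => kP.
apply/idP/idP => [k_lt|tP].
  have : (-1)%:~R < (k%:~R : R) < 1%:~R by rewrite intrN; lra.
  rewrite !ltr_int => k01; have k0 : k = 0 by clear -k01; lia.
  by move: k_lt kP; rewrite k0; lra.
have : (-1)%:~R < (k%:~R : R) < 1%:~R by rewrite intrN; lra.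
rewrite !ltr_int => k01; have -> : k = 0 by clear -k01; lia.
by lra.
Qed.

(** The [L] arcs tile the circle: a point at clockwise distance [t] from 0 lies only in the arc
    numbered by the integer part of [t / eps]. *)
Lemma lev_sum_arcs (X : {fset circle R}) :
  lev i X r = (\sum_(a < L) #|` arc_level_points r (origin a) i eps X|)%N.
Proof.
rewrite lev_level_points// card_fset_sum1.
under [RHS]eq_bigr => a _.
  rewrite /arc_level_points card_fset_sum1 -big_fset_condE /=; over.
rewrite [RHS](exchange_big_dep xpredT)//=; apply: eq_bigr => x _.
have e0 := eps_gt0; set t := clockwise_dist 0 x.
have t0 : 0 <= t / eps by rewrite divr_ge0 ?clockwise_dist_ge0// ltW.
have tL : (Num.truncn (t / eps) < L)%N.
  rewrite -(ltr_nat R) (@le_lt_trans _ _ (t / eps)) ?truncn_le//.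
  by rewrite invrK -[ltRHS]mul1r ltr_pM2r ?ltr0n// clockwise_dist_lt1.
rewrite (bigD1 (Ordinal tL)) /=; last first.
  rewrite (clockwise_dist_origin (Ordinal tL)) /= -ler_pdivlMr// -ltr_pdivrMr//.
  exact: truncn_itv.
rewrite big1 ?addn0// => a /andP[]; rewrite clockwise_dist_origin.
rewrite -ler_pdivlMr// -ltr_pdivrMr// => aP /eqP[]; apply: val_inj => /=.
by apply/esym/truncn_def; rewrite aP.
Qed.

Let cell_law o (x : option ('I_m * 'I_M)) : R :=
  fine (circle_uniform (cell r o m' M delta @^-1` [set x])).

Let cell_Some o (ck : 'I_m * 'I_M) : cell r o m' M delta @^-1` [set Some ck] =
  arc (window_point r o ck.1 0) (ck.2%:R * delta) (ck.2.+1%:R * delta).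
Proof.
by apply/seteqP; split=> x /=; rewrite (cell_SomeP delta_gt0 epsE (@window_disjoint o)).
Qed.

Let cell_bounds (k : 'I_M) : 0 <= k%:R * delta /\ k.+1%:R * delta <= 1.
Proof.
have d0 := delta_gt0; split; first by rewrite mulr_ge0// ltW.
by rewrite (le_trans _ eps_le1)// [leRHS]epsE ler_pM2r// ler_nat.
Qed.

Let measurable_cell o x : measurable (cell r o m' M delta @^-1` [set x]).
Proof.
have mS ck : measurable (cell r o m' M delta @^-1` [set Some ck]).
  by rewrite cell_Some; have [? ?] := cell_bounds ck.2; exact: measurable_arc.
case: x => [ck//|].
rewrite (_ : _ @^-1` _ = ~` \bigcup_(ck in [set: 'I_m * 'I_M])
    (cell r o m' M delta @^-1` [set Some ck])).
  by apply: measurableC; apply: fin_bigcup_measurable.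
apply/seteqP; split=> x /= => [xN [ck _ /= xS]|xN]; first by rewrite xN in xS.
by case E : (cell _ _ _ _ _ x) => [ck|]//; exfalso; apply: xN; exists ck.
Qed.

Let cell_law_ge0 o x : 0 <= cell_law o x.
Proof. by apply: fine_ge0; exact: (measure_ge0 (uniform_prob (@ltr01 R))). Qed.

Let cell_law_sum1 o : \sum_x cell_law o x = 1.
Proof.
exact: (sum_finite_valued (uniform_prob (@ltr01 R))
  (f := cell r o m' M delta \o @to_circle R) (measurable_cell o)).
Qed.

Let cell_lawE o ck : cell_law o (Some ck) = delta.
Proof.
have [k0 k1] := cell_bounds ck.2; have d0 := delta_gt0.
rewrite /cell_law cell_Some circle_uniform_arc//=; last first.
  by rewrite ler_pM2r// ler_nat.
by rewrite -natr1 mulrDl mul1r addrAC subrr add0r.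
Qed.

Context d (T : measurableType d) (P : probability T R).
Variable X : 'I_n -> {RV P >-> circle R}.
Hypothesis hX : iid_uniform X.

Let conf a w := config_of r (origin a) m' M delta (fun l => X l w).

Let conf_fiber a v : conf a @^-1` [set v] =
  \bigcap_l (X l @^-1` (cell r (origin a) m' M delta @^-1` [set v l])).
Proof.
apply/seteqP; split=> w /=; first by move=> <- l _ /=; rewrite ffunE.
by move=> wv; apply/ffunP => l; rewrite ffunE; apply: (wv l).
Qed.

Let measurable_conf a v : measurable (conf a @^-1` [set v]).
Proof.
rewrite conf_fiber -[Y in measurable Y]setCK setC_bigcap; apply: measurableC.
apply: fin_bigcup_measurable => // l _; apply: measurableC.
exact: measurable_funPTI (measurable_cell _ _).
Qed.

Let conf_law a v : fine (P (conf a @^-1` [set v])) = weight (cell_law (origin a)) v.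
Proof.
case: hX => indep unif.
rewrite conf_fiber indep; last by move=> l; exact: measurable_cell.
rewrite (eq_bigr (fun l => (cell_law (origin a) (v l))%:E)) ?prodEFin// => l _.
have /= := unif l _ (measurable_cell (origin a) (v l)).
rewrite /distribution /pushforward => ->; rewrite fineK//.
exact: (fin_num_measure (uniform_prob (@ltr01 R)) _ (measurable_cell _ _)).
Qed.

Let h : R := success_prob R m i (1, 0)%N.
Let K : R := (m * potential i (1, 0))%:R.
Let err : R := n%:R * (n%:R ^+ 2 * (M%:R * (m%:R * delta) ^+ 2)).

Let integral_conf (G : {ffun 'I_n -> option ('I_m * 'I_M)} -> R) :
  (forall v, 0 <= G v) ->
  (\int[P]_w (\sum_(a < L) (G (conf a w))%:E) =
   (\sum_(a < L) \sum_v weight (cell_law (origin a)) v * G v)%:E)%E.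
Proof.
move=> G0; rewrite ge0_integral_sum//; last 2 first.
- by move=> a; exact: measurable_finite_valued (measurable_conf a) _.
- by move=> a w _; rewrite lee_fin.
rewrite -sumEFin; apply: eq_bigr => a _.
rewrite (integral_finite_valued P (measurable_conf a))//; congr (_%:E).
by apply: eq_bigr => v _; rewrite conf_law.
Qed.

Let sum_arcs_const (x : R) : \sum_(a < L) (n%:R * (M%:R * delta) * h + x) = n%:R * h + L%:R * x.
Proof.
rewrite sumr_const card_ord -[LHS]mulr_natl -epsE.
by field; rewrite pnatr_eq0 -lt0n.
Qed.

(** On each arc the count is squeezed between functions of the finitely valued [conf a], whose
    integrals are weighted sums. Expectations add over the arcs whatever their dependence, and the
    error is paid [L] times. *)
Lemma expected_lev_bounds :
  ((n%:R * h - L%:R * (K + err))%:E <=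
    'E_P[fun w => (lev i (random_set X w) r)%:R] <=
  (n%:R * h + L%:R * (K + err))%:E)%E.
Proof.
rewrite unlock.
have levE w : ((lev i (random_set X w) r)%:R : R)%:E =
    (\sum_(a < L) (#|` arc_level_points r (origin a) i eps (random_set X w)|%:R : R)%:E)%E.
  by rewrite lev_sum_arcs natr_sum sumEFin.
apply/andP; split.
  pose G (v : {ffun 'I_n -> option ('I_m * 'I_M)}) : R :=
    if collision_free v then (success_count i v)%:R else 0.
  have G0 v : 0 <= G v by rewrite /G; case: ifP.
  have lo : ((n%:R * h - L%:R * (K + err))%:E <=
      \int[P]_w (\sum_(a < L) (G (conf a w))%:E))%E.
    rewrite integral_conf// lee_fin -mulrN -sum_arcs_const; apply: ler_sum => a _.
    rewrite opprD addrA.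
    exact: (sum_weight_success_ge n i (cell_law_ge0 _) (cell_law_sum1 _) (cell_lawE _)).
  apply: le_trans lo _; apply: ge0_le_integral_nonmeasurable => w.
    by apply: sume_ge0 => a _; rewrite lee_fin.
  rewrite levE; apply: lee_sum => a _; rewrite lee_fin /G; case: ifP => // cf.
  rewrite ler_nat; exact: (success_count_le r_gt0 r_le1 eps_le delta_gt0 epsE
    (@window_modn _) (@window_disjoint _) cf).
pose G (v : {ffun 'I_n -> option ('I_m * 'I_M)}) : R :=
  if collision_free v then (success_count i v + undecided_count i v)%N%:R else n%:R.
have G0 v : 0 <= G v by rewrite /G; case: ifP.
have up : (\int[P]_w (\sum_(a < L) (G (conf a w))%:E) <=
    (n%:R * h + L%:R * (K + err))%:E)%E.
  rewrite integral_conf// lee_fin -sum_arcs_const; apply: ler_sum => a _.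
  rewrite addrA.
  exact: (sum_weight_success_le n i (cell_law_ge0 _) (cell_law_sum1 _) (cell_lawE _)).
apply: le_trans up; apply: ge0_le_integral_nonmeasurable => w; first by rewrite lee_fin.
rewrite levE; apply: lee_sum => a _; rewrite lee_fin.
have := arc_level_points_le r_gt0 r_le1 eps_le delta_gt0 epsE
  (@window_modn (origin a)) (@window_disjoint (origin a)) (fun l => X l w).
by rewrite -(ler_nat R) /G; case: ifP.
Qed.

End expected_level.

(** * Choice of the cells and passage to the limit *)

Section limit.
Variable R : realType.

Lemma exists_inv_nat_le (s : seq R) : (forall x, x \in s -> 0 < x) ->
  exists2 L, (0 < L)%N & forall x, x \in s -> L%:R^-1 <= x.
Proof.
elim: s => [|x s IHs] s0; first by exists 1%N.
have [|L L0 Ls] := IHs; first by move=> y ys; apply: s0; rewrite inE ys orbT.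
have x0 : 0 < x by apply: s0; rewrite mem_head.
pose k := (Num.truncn x^-1).+1.
exists (maxn L k) => [|y]; first by rewrite leq_max L0.
have le_inv (a b : nat) : (0 < a)%N -> (a <= b)%N -> b%:R^-1 <= a%:R^-1 :> R.
  move=> a0 ab; rewrite lef_pV2 ?ler_nat// posrE ltr0n//.
  exact: leq_trans ab.
rewrite inE => /predU1P[->|/Ls]; last by apply: le_trans; rewrite le_inv ?leq_maxl.
apply: (@le_trans _ _ k%:R^-1); first by rewrite le_inv ?leq_maxr.
have x'0 : 0 <= x^-1 by rewrite invr_ge0 ltW.
have /andP[_ xk] := truncn_itv x'0.
by rewrite -[leRHS]invrK lef_pV2 ?posrE ?ltr0n ?invr_gt0// ltW.
Qed.

(** For a common point, [u' - u] and the fractional part t of [(c' - c) * r] would differ by an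
    integer. But [u' - u] is less than 1/L in absolute value, while t is at least 1/L away from 0
    and from 1. *)
Lemma window_separation (r : R) (m' L : nat) (o : circle R) (c c' : 'I_m'.+1) x :
  (forall j, (0 < j <= m')%N -> let t := j%:R * r - (Num.floor (j%:R * r))%:~R in
     L%:R^-1 <= t /\ L%:R^-1 <= 1 - t) ->
  clockwise_dist (window_point r o c 0) x < L%:R^-1 ->
  clockwise_dist (window_point r o c' 0) x < L%:R^-1 -> c = c'.
Proof.
move=> sep; wlog : c c' / (c <= c')%N => [hw xc xc'|cc' xc xc'].
  have [cc'|cc'] := leqP c c'; first exact: hw.
  by apply/esym; apply: hw => //; exact: ltnW.
apply: val_inj => /=; apply/eqP; apply: contraTT isT => ne.
have jm : (0 < c' - c <= m')%N by move: ne (ltn_ord c') => /eqP; clear -cc'; lia.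
have := sep _ jm; set j := (c' - c)%N; set k := Num.floor _ => /= -[t0 t1].
set e := L%:R^-1 in xc xc' t0 t1.
set u := clockwise_dist _ _ in xc; set u' := clockwise_dist _ _ in xc'.
have u0 : 0 <= u by exact: clockwise_dist_ge0.
have u'0 : 0 <= u' by exact: clockwise_dist_ge0.
have : to_circle (u' - u - j%:R * r + k%:~R) = 0.
  have : window_point r o c 0 + to_circle u = window_point r o c' 0 + to_circle u'.
    by rewrite !clockwise_distK.
  rewrite !window_point_shift /window_point => /addrI.
  rewrite !add0r => /eqP; rewrite eq_sym -subr_eq0 -to_circleB => /eqP E.
  have k0 : to_circle (k%:~R : R) = 0 by apply/to_circle_eq0; rewrite intr_int.
  rewrite to_circleD k0 addr0 -[RHS]E; congr to_circle.
  by rewrite /j natrB//; ring.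
move=> /to_circle_eq0 /intrP[l lE].
have : (-1)%:~R < (l%:~R : R) < 0%:~R by rewrite -lE intrN; lra.
by rewrite !ltr_int; clear; lia.
Qed.

(** Either [j] is already below [m], or rotation by [m * r] is trivial. *)
Lemma window_periodic (r : R) (m i : nat) (o : circle R) j u : (0 < m)%N ->
  (i.+2 <= m)%N \/ m%:R * r \is a Num.int -> (j <= i.+1)%N ->
  window_point r o j u = window_point r o (j %% m)%N u.
Proof.
move=> m0 [im|mr] ji; first by rewrite modn_small// (leq_ltn_trans ji).
rewrite /window_point {1}(divn_eq j m) natrD natrM; congr (_ + _).
apply/eqP; rewrite -subr_eq0 -to_circleB; apply/eqP/to_circle_eq0.
rewrite (_ : _ - _ = - ((j %/ m)%:R * (m%:R * r))); last by ring.
by rewrite rpredN rpredM// natr_int.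
Qed.

Lemma expected_fraction_cvg (r : R) (i m : nat)
    (d : nat -> measure_display) (Omega : forall n : nat, measurableType (d n))
    (P : forall n : nat, probability (Omega n) R)
    (X : forall n : nat, 'I_n -> {RV (P n) >-> circle R}) :
  0 < r -> r <= 1 -> (0 < m)%N ->
  (forall j, (0 < j < m)%N -> j%:R * r \isn't a Num.int) ->
  (i.+2 <= m)%N \/ m%:R * r \is a Num.int ->
  (forall n : nat, iid_uniform (X n)) ->
  ('E_(P n)[fun w => (lev i (random_set (X n) w) r)%:R] * (n%:R^-1)%:E)%E
    @[n --> \oo] --> ((walks m (2 * i).+1 1)%:R / 2 ^+ (2 * i).+1)%:E.
Proof.
move=> r0 r1; case: m => // m' _ mN mP hX.
pose frac j : R := j%:R * r - (Num.floor (j%:R * r))%:~R.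
have frac_itv j : (0 < j < m'.+1)%N -> 0 < frac j < 1.
  move=> jm; have := floor_itv (j%:R * r); rewrite intrD => fl.
  have : frac j != 0 by rewrite subr_eq0 eq_sym -intrEfloor mN.
  by rewrite neq_lt /frac; lra.
(* Arcs of length 1/L are to be no longer than [r] and to have disjoint translates in the windows 0,
   ..., m - 1. *)
have [|L L0 Ls] := @exists_inv_nat_le
    (r :: [seq frac j | j <- iota 1 m'] ++ [seq 1 - frac j | j <- iota 1 m']).
  move=> x; rewrite inE mem_cat => /predU1P[->//|/orP[]] /mapP[j];
    by rewrite mem_iota => jm ->; have := frac_itv j; rewrite -add1n => /(_ jm); lra.
have eps_le : (L%:R^-1 : R) <= r by apply: Ls; rewrite mem_head.
have sep j : (0 < j <= m')%N -> let t := frac j in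
    L%:R^-1 <= t /\ L%:R^-1 <= 1 - t.
  move=> jm; split; apply: Ls; rewrite inE mem_cat.
    by rewrite (map_f frac) ?orbT// mem_iota add1n ltnS.
  by rewrite (map_f (fun j => 1 - frac j)) ?orbT// mem_iota add1n ltnS.
set h : R := _ / _.
have hE : success_prob R m'.+1 i (1, 0)%N = h.
  rewrite /success_prob /= subSS !subn0 (_ : i + i.+1 = (2 * i).+1)%N//.
  by clear; lia.
pose K : R := (m'.+1 * potential i (1, 0))%:R.
(* The second summand is the collision error for [M = n ^ 3], in which [n] cancels. *)
pose C : R := L%:R * (K + m'.+1%:R ^+ 2 / L%:R ^+ 2).
have inv0 : (n%:R^-1 : R) @[n --> \oo] --> 0.
  by rewrite -(cvg_shiftS (fun n : nat => n%:R^-1 : R)); exact: cvg_harmonic.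
have C0 : C / n%:R @[n --> \oo] --> (0 : R).
  by rewrite -[X in _ --> X](mulr0 C); apply: cvgMr.
apply: (@squeeze_cvge _ _ _ _ (fun n => (h - C / n%:R)%:E) _
  (fun n => (h + C / n%:R)%:E)); last 2 first.
- apply: cvg_EFin; first by near=> n.
  by rewrite -[X in _ --> X](subr0 h); apply: cvgB C0; apply: cvg_cst.
- apply: cvg_EFin; first by near=> n.
  by rewrite -[X in _ --> X](addr0 h); apply: cvgD C0; apply: cvg_cst.
near=> n.
have n0 : (0 < n)%N by near: n; exact: nbhs_infty_gt.
have n0' : 0 < n%:R :> R by rewrite ltr0n.
have M0 : (0 < n ^ 3)%N by rewrite expn_gt0 n0.
have := @expected_lev_bounds R r m' i L (n ^ 3) n r0 r1 eps_le L0 M0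
  (fun o j u => @window_periodic r m'.+1 i o j u isT mP)
  (fun o c c' x => @window_separation r m' L o c c' x sep)
  _ _ (P n) (X n) (hX n).
rewrite hE.
have -> : n%:R * (n%:R ^+ 2 * ((n ^ 3)%:R *
    (m'.+1%:R * (L%:R^-1 / (n ^ 3)%:R)) ^+ 2)) = m'.+1%:R ^+ 2 / L%:R ^+ 2 :> R.
  have : L%:R != 0 :> R by rewrite pnatr_eq0 -lt0n.
  rewrite natrX; move: (m'.+1%:R : R) (L%:R : R) (n%:R : R) n0' => a b c c0 b0.
  by field; rewrite b0 gt_eqF.
rewrite -/K -/C; move: ('E_(P n)[_])%E => E /andP[lo hi].
apply/andP; split.
  rewrite (_ : h - C / n%:R = (n%:R * h - C) / n%:R); last by field; rewrite gt_eqF.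
  by rewrite EFinM lee_pmul2r// lte_fin invr_gt0.
rewrite (_ : h + C / n%:R = (n%:R * h + C) / n%:R); last by field; rewrite gt_eqF.
by rewrite EFinM lee_pmul2r// lte_fin invr_gt0.
Unshelve. all: by end_near. Qed.

End limit.

Theorem theorem4p3 (R : realType) (r : R) (hr0 : 0 < r) (hr1 : r <= 1)
    (i : nat) (d : nat -> measure_display)
    (Omega : forall n : nat, measurableType (d n))
    (P : forall n : nat, probability (Omega n) R)
    (X : forall n : nat, 'I_n -> {RV (P n) >-> circle R})
    (hX : forall n : nat, iid_uniform (X n)) :
  let expected_fraction (n : nat) : \bar R :=
    ('E_(P n)[fun w => (lev i (random_set (X n) w) r)%:R] * (n%:R^-1)%:E)%E in
  (irrational r ->
     expected_fraction n @[n --> \oo] -->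
       (1 / 2 ^+ (2 * i + 1) * catalan R i)%:E) /\
  (forall p q : nat, (0 < p)%N -> (0 < q)%N -> coprime p q ->
     r = p%:R / q%:R ->
     expected_fraction n @[n --> \oo] -->
       (1 / 2 ^+ (2 * i + 1) * (bounded_catalan i (q%:Z - 2))%:R)%:E).
Proof.
move=> expected_fraction; split=> [r_irr|p q p0 q0 pq rE].
  (* With [m = i.+2] letters the barrier is out of reach of a walk of this length. *)
  have := @expected_fraction_cvg R r i i.+2 d Omega P X hr0 hr1 isT.
  rewrite walks_catalan// addn1 mul1r [X in X%:E]mulrC; apply=> //; last by left.
  move=> j /andP[j0 _]; apply/negP => /intrP[k jk]; apply: r_irr.
  apply/rationalP; exists k, j; rewrite -jk mulrC mulKf// pnatr_eq0 -lt0n//.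
(* Here [m = q]: [q * r] is an integer, and by coprimality no smaller positive multiple of [r]
   is. *)
have := @expected_fraction_cvg R r i q d Omega P X hr0 hr1 q0.
have q0' : q%:R != 0 :> R by rewrite pnatr_eq0 -lt0n.
rewrite walks_bounded_catalan addn1 mul1r [X in X%:E]mulrC; apply=> //.
  move=> j /andP[j0 jq]; apply/negP => /intrP[k].
  rewrite rE mulrA => /(canRL (divfK q0')) /eqP; rewrite -natrM.
  rewrite -[(j * p)%:R]/((j * p)%:Z%:~R) -[q%:R]/(q%:Z%:~R) -intrM eqr_int => /eqP jpk.
  have : (q %| j * p)%N.
    have : (q%:Z %| (j * p)%:Z)%Z by rewrite jpk dvdz_mull.
    by rewrite /dvdz.
  rewrite Gauss_dvdl; last by rewrite coprime_sym.
  by move/(dvdn_leq j0); rewrite leqNgt jq.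
by right; rewrite rE mulrC divfK// natr_int.
Qed.
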